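(* Let $m$ be a positive integer and $\mathbf{Q}=(Q_1,\dots,Q_{m-1})\in\mathbb{C}^{m-1}$. For every $(\boldsymbol{\varphi},\boldsymbol{\beta},\mathbf{h})\in\prod_{i=1}^{m-1}\big(\mathbb{C}[x]_{\mathrm{monic}}^{\langle Q_i\rangle}\times\mathbb{B}^{\langle Q_i\rangle}\big)\times\prod_{t\ge0}\mathbb{C}$, the simple highest weight $U(\mathfrak{gl}_m^{\langle\mathbf{Q}\rangle}[x])$-module $\mathcal{L}(\widetilde{\mathbf{u}}^{\langle\mathbf{Q}\rangle}(\boldsymbol{\varphi},\boldsymbol{\beta},\mathbf{h}))$ of highest weight $\widetilde{\mathbf{u}}^{\langle\mathbf{Q}\rangle}(\boldsymbol{\varphi},\boldsymbol{\beta},\mathbf{h})$ is finite dimensional. For $(\boldsymbol{\varphi},\boldsymbol{\beta},\mathbf{h}),(\boldsymbol{\varphi}',\boldsymbol{\beta}',\mathbf{h}')$ in this set one has $$\mathcal{L}(\widetilde{\mathbf{u}}^{\langle\mathbf{Q}\rangle}(\boldsymbol{\varphi},\boldsymbol{\beta},\mathbf{h}))\cong\mathcal{L}(\widetilde{\mathbf{u}}^{\langle\mathbf{Q}\rangle}(\boldsymbol{\varphi}',\boldsymbol{\beta}',\mathbf{h}'))\iff(\boldsymbol{\varphi},\boldsymbol{\beta},\mathbf{h})=(\boldsymbol{\varphi}',\boldsymbol{\beta}',\mathbf{h}').$$ Moreover, $$\Big\{\mathcal{L}(\widetilde{\mathbf{u}}^{\langle\mathbf{Q}\rangle}(\boldsymbol{\varphi},\boldsymbol{\beta},\mathbf{h}))\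 \Big|\ (\boldsymbol{\varphi},\boldsymbol{\beta},\mathbf{h})\in\prod_{i=1}^{m-1}\big(\mathbb{C}[x]_{\mathrm{monic}}^{\langle Q_i\rangle}\times\mathbb{B}^{\langle Q_i\rangle}\big)\times\prod_{t\ge0}\mathbb{C}\Big\}$$ gives a complete set of isomorphism classes of finite dimensional simple $U(\mathfrak{gl}_m^{\langle\mathbf{Q}\rangle}[x])$-modules.
   Context: **Lie algebra.** $\mathfrak{gl}_m^{\langle\mathbf{Q}\rangle}[x]$ is the Lie algebra over $\mathbb{C}$ with generators $\mathcal{X}_{i,t}^{\pm}$ ($1\le i\le m-1$, $t\ge0$), $\mathcal{I}_{j,t}$ ($1\le j\le m$, $t\ge0$) and defining relations (for all indices in range and all $s,t,u\ge0$), where $\mathcal{J}_{i,t}:=\mathcal{I}_{i,t}-\mathcal{I}_{i+1,t}$: (L'1) $[\mathcal{I}_{i,s},\mathcal{I}_{j,t}]=0$; (L'2) $[\mathcal{I}_{j,s},\mathcal{X}_{i,t}^{\pm}]=\pm a'_{ji}\mathcal{X}_{i,s+t}^{\pm}$, where $a'_{ji}=1$ if $j=i$, $-1$ if $j=i+1$, $0$ otherwise; (L'3) $[\mathcal{X}_{i,t}^+,\mathcal{X}_{j,s}^-]=\delta_{ij}(\mathcal{J}_{i,s+t}-Q_i\mathcal{J}_{i,s+t+1})$; (L4) $[\mathcal{X}_{i,t}^{\pm},\mathcal{X}_{j,s}^{\pm}]=0$ if $j\ne i\pm1$; (L5) $[\mathcal{X}_{i,t+1}^+,\mathcal{X}_{i\pm1,s}^+]=[\mathcal{X}_{i,t}^+,\mathcal{X}_{i\pm1,s+1}^+]$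 and $[\mathcal{X}_{i,t+1}^-,\mathcal{X}_{i\pm1,s}^-]=[\mathcal{X}_{i,t}^-,\mathcal{X}_{i\pm1,s+1}^-]$; (L6) $[\mathcal{X}_{i,s}^+,[\mathcal{X}_{i,t}^+,\mathcal{X}_{i\pm1,u}^+]]=[\mathcal{X}_{i,s}^-,[\mathcal{X}_{i,t}^-,\mathcal{X}_{i\pm1,u}^-]]=0$. $U(\cdot)$ denotes the universal enveloping algebra. **Highest weight modules.** For $\widetilde{\mathbf{u}}=(\widetilde u_{j,t})\in\prod_{j=1}^{m}\prod_{t\ge0}\mathbb{C}$, a highest weight module of highest weight $\widetilde{\mathbf{u}}$ is a $U(\mathfrak{gl}_m^{\langle\mathbf{Q}\rangle}[x])$-module generated by a nonzero vector $v_0$ with $\mathcal{X}_{i,t}^+v_0=0$ and $\mathcal{I}_{j,t}v_0=\widetilde u_{j,t}v_0$ for all $i,j,t$. The Verma module $\mathcal{M}(\widetilde{\mathbf{u}})$ is the quotient of $U(\mathfrak{gl}_m^{\langle\mathbf{Q}\rangle}[x])$ by the left ideal generated by all $\mathcal{X}_{i,t}^+$ and all $\mathcal{I}_{j,t}-\widetilde u_{j,t}$; it has a unique maximal proper submodule $\operatorname{rad}\mathcal{M}(\widetilde{\mathbf{u}})$, and $\mathcal{L}(\widetilde{\mathbf{u}})=\mathcal{M}(\widetilde{\mathbf{u}})/\operatorname{rad}\mathcal{M}(\widetilde{\mathbf{u}})$. **Parameters.** For $Q\in\mathbb{C}$: $\mathbb{B}^{\langle Q\rangle}=\{0\}$ if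 $Q=0$ and $\mathbb{B}^{\langle Q\rangle}=\mathbb{C}$ if $Q\ne0$. $\mathbb{C}[x]_{\mathrm{monic}}^{\langle Q\rangle}$ is the set of all monic polynomials in $\mathbb{C}[x]$ if $Q=0$, and the set of monic polynomials of which $Q^{-1}$ is not a root if $Q\ne0$. For $(\boldsymbol{\varphi},\boldsymbol{\beta})=((\varphi_i,\beta_i))_{1\le i\le m-1}$ with $\varphi_i=(x-\gamma_{i,1})\cdots(x-\gamma_{i,n_i})$, put $\mathbf{u}^{\langle\mathbf{Q}\rangle}(\boldsymbol{\varphi},\boldsymbol{\beta})_{i,t}=\deg\varphi_i+\beta_i$ if $t=0$; $=\gamma_{i,1}^t+\dots+\gamma_{i,n_i}^t$ if $t>0$ and $Q_i=0$; $=\gamma_{i,1}^t+\dots+\gamma_{i,n_i}^t+Q_i^{-t}\beta_i$ if $t>0$ and $Q_i\ne0$. For $\mathbf{h}=(h_t)_{t\ge0}$, the element $\widetilde{\mathbf{u}}^{\langle\mathbf{Q}\rangle}(\boldsymbol{\varphi},\boldsymbol{\beta},\mathbf{h})\in\prod_{j=1}^m\prod_{t\ge0}\mathbb{C}$ has components $\sum_{k=j}^{m-1}\mathbf{u}^{\langle\mathbf{Q}\rangle}(\boldsymbol{\varphi},\boldsymbol{\beta})_{k,t}+h_t$ for $1\le j\le m-1$, $t\ge0$, and $h_t$ for $j=m$, $t\ge0$. *)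

(* Defs.v *)
From HB Require Import structures.
From mathcomp Require Import all_boot all_order all_algebra.
From mathcomp Require Import ring_quotient.
From mathcomp Require Import boolp classical_sets reals.
From mathcomp Require Export complex.

Set Implicit Arguments.
Unset Strict Implicit.
Unset Printing Implicit Defensive.

Import GRing.Theory.
Local Open Scope ring_scope.
Local Open Scope quotient_scope.

HB.mixin Record Lmodule_isLieAlgebra (F : fieldType) L of GRing.Lmodule F L := {
  lie_br : L -> L -> L;
  lie_brDl : forall x y z, lie_br (x + y) z = lie_br x z + lie_br y z;
  lie_brDr : forall x y z, lie_br x (y + z) = lie_br x y + lie_br x z;
  lie_brZl : forall (a : F) x y, lie_br (a *: x) y = a *: lie_br x y;
  lie_brZr : forall (a : F) x y, lie_br x (a *: y) = a *: lie_br x y;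
  lie_brxx : forall x, lie_br x x = 0;
  lie_jacobi : forall x y z,
    lie_br x (lie_br y z) + lie_br y (lie_br z x) + lie_br z (lie_br x y) = 0
}.

#[short(type="lieAlgType")]
HB.structure Definition LieAlgebra (F : fieldType) :=
  {L of GRing.Lmodule F L & Lmodule_isLieAlgebra F L}.

(* The Lie algebra over F with generators G and relations rels is the set of
   formal Lie expressions in G modulo the smallest congruence containing the
   Lie algebra axioms and rels. *)
Inductive lie_term (F : Type) (G : Type) : Type :=
| LGen of G
| LZero
| LAdd of lie_term F G & lie_term F G
| LOpp of lie_term F G
| LScale of F & lie_term F G
| LBr of lie_term F G & lie_term F G.

Arguments LGen {F G}.
Arguments LZero {F G}.

HB.instance Definition _ F G := gen_eqMixin (lie_term F G).
HB.instance Definition _ F G := gen_choiceMixin (lie_term F G).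

Declare Scope lie_term_scope.
Delimit Scope lie_term_scope with LT.
Bind Scope lie_term_scope with lie_term.
Notation "0" := LZero : lie_term_scope.
Notation "x + y" := (LAdd x y) : lie_term_scope.
Notation "- x" := (LOpp x) : lie_term_scope.
Notation "x - y" := (LAdd x (LOpp y)) : lie_term_scope.
Notation "a *: x" := (LScale a%R x) : lie_term_scope.
Notation "[ 'br' x , y ]" := (LBr x y) (format "[ 'br'  x ,  y ]") :
  lie_term_scope.

Section PresentedLie.
Variables (F : fieldType) (G : Type).
Variable rels : lie_term F G -> lie_term F G -> Prop.

Inductive lie_cong : lie_term F G -> lie_term F G -> Prop :=
| lc_rel x y : rels x y -> lie_cong x y
| lc_refl x : lie_cong x x
| lc_sym x y : lie_cong x y -> lie_cong y x
| lc_trans x y z : lie_cong x y -> lie_cong y z -> lie_cong x z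
| lc_add x x' y y' :
    lie_cong x x' -> lie_cong y y' -> lie_cong (x + y) (x' + y')
| lc_opp x x' : lie_cong x x' -> lie_cong (- x) (- x')
| lc_scale a x x' : lie_cong x x' -> lie_cong (a *: x) (a *: x')
| lc_br x x' y y' :
    lie_cong x x' -> lie_cong y y' -> lie_cong [br x, y] [br x', y']
| lc_addA x y z : lie_cong (x + (y + z)) (x + y + z)
| lc_addC x y : lie_cong (x + y) (y + x)
| lc_add0 x : lie_cong (0 + x) x
| lc_addN x : lie_cong (- x + x) 0
| lc_scaleA a b x : lie_cong (a *: (b *: x)) ((a * b) *: x)
| lc_scale1 x : lie_cong (1 *: x) x
| lc_scaleDr a x y : lie_cong (a *: (x + y)) (a *: x + a *: y)
| lc_scaleDl a b x : lie_cong ((a + b) *: x) (a *: x + b *: x)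
| lc_brDl x y z : lie_cong [br x + y, z] ([br x, z] + [br y, z])
| lc_brDr x y z : lie_cong [br x, y + z] ([br x, y] + [br x, z])
| lc_brZl a x y : lie_cong [br a *: x, y] (a *: [br x, y])
| lc_brZr a x y : lie_cong [br x, a *: y] (a *: [br x, y])
| lc_brxx x : lie_cong [br x, x] 0
| lc_jacobi x y z :
    lie_cong ([br x, [br y, z]] + [br y, [br z, x]] + [br z, [br x, y]]) 0.

Definition lie_eqv : rel (lie_term F G) := fun x y => `[< lie_cong x y >].

Lemma lie_eqv_equiv : equiv_class_of lie_eqv.
Proof.
split=> [x|x y|y x z].
- by apply/asboolP; exact: lc_refl.
- by apply/idP/idP => /asboolP h; apply/asboolP; exact: lc_sym.
- by move=> /asboolP h /asboolP k; apply/asboolP; exact: lc_trans h k.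
Qed.

Canonical lie_eqv_canonical := EquivRelPack lie_eqv_equiv.
Canonical lie_eqv_encModRel := defaultEncModRel lie_eqv.

Definition presented_lie := {eq_quot lie_eqv}.
HB.instance Definition _ : EqQuotient _ lie_eqv presented_lie :=
  EqQuotient.on presented_lie.
HB.instance Definition _ := Choice.on presented_lie.

Local Notation L := presented_lie.
Local Notation pi := (\pi_L).

Lemma lie_piP x y : pi x = pi y <-> lie_cong x y.
Proof.
split=> [/eqmodP/asboolP //|h]; apply/eqmodP; exact/asboolP.
Qed.

Lemma lie_reprK x : lie_cong (repr (pi x)) x.
Proof. by apply/lie_piP; rewrite reprK. Qed.

Definition pl_zero : L := lift_cst L LZero.
Definition pl_add := lift_op2 L (@LAdd F G).
Definition pl_opp := lift_op1 L (@LOpp F G).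
Definition pl_scale (a : F) := lift_op1 L (LScale a).
Definition pl_br := lift_op2 L (@LBr F G).

Lemma pl_addE x y : pl_add (pi x) (pi y) = pi (LAdd x y).
Proof. by rewrite /pl_add -lock; apply/lie_piP; apply: lc_add; exact: lie_reprK. Qed.
Lemma pl_oppE x : pl_opp (pi x) = pi (LOpp x).
Proof. by rewrite /pl_opp -lock; apply/lie_piP; apply: lc_opp; exact: lie_reprK. Qed.
Lemma pl_scaleE a x : pl_scale a (pi x) = pi (LScale a x).
Proof. by rewrite /pl_scale -lock; apply/lie_piP; apply: lc_scale; exact: lie_reprK. Qed.
Lemma pl_brE x y : pl_br (pi x) (pi y) = pi (LBr x y).
Proof. by rewrite /pl_br -lock; apply/lie_piP; apply: lc_br; exact: lie_reprK. Qed.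

Lemma pl_zeroE : pl_zero = pi LZero.
Proof. by rewrite /pl_zero -lock. Qed.

Let plE := (pl_zeroE, pl_addE, pl_oppE, pl_scaleE, pl_brE).

Fact pl_addA : associative pl_add.
Proof.
elim/quotW=> x; elim/quotW=> y; elim/quotW=> z.
by rewrite !plE; apply/lie_piP; exact: lc_addA.
Qed.
Fact pl_addC : commutative pl_add.
Proof.
by elim/quotW=> x; elim/quotW=> y; rewrite !plE; apply/lie_piP; exact: lc_addC.
Qed.
Fact pl_add0 : left_id pl_zero pl_add.
Proof. by elim/quotW=> x; rewrite !plE; apply/lie_piP; exact: lc_add0. Qed.
Fact pl_addN : left_inverse pl_zero pl_opp pl_add.
Proof. by elim/quotW=> x; rewrite !plE; apply/lie_piP; exact: lc_addN. Qed.

HB.instance Definition _ :=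
  GRing.isZmodule.Build presented_lie pl_addA pl_addC pl_add0 pl_addN.

Lemma pl_pi0 : 0 = pi LZero :> L.
Proof. exact: pl_zeroE. Qed.
Lemma pl_piD (x y : lie_term F G) : (pi x : L) + pi y = pi (LAdd x y).
Proof. exact: pl_addE. Qed.

Fact pl_scaleA a b x : pl_scale a (pl_scale b x) = pl_scale (a * b) x.
Proof.
by elim/quotW: x => x; rewrite !plE; apply/lie_piP; exact: lc_scaleA.
Qed.
Fact pl_scale1 : left_id 1 pl_scale.
Proof. by elim/quotW=> x; rewrite !plE; apply/lie_piP; exact: lc_scale1. Qed.
Fact pl_scaleDr : right_distributive pl_scale +%R.
Proof.
move=> a; elim/quotW=> x; elim/quotW=> y.
by rewrite !(pl_piD, plE); apply/lie_piP; exact: lc_scaleDr.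
Qed.
Fact pl_scaleDl x : {morph pl_scale^~ x : a b / a + b}.
Proof.
move=> a b /=; elim/quotW: x => x.
by rewrite !(pl_piD, plE); apply/lie_piP; exact: lc_scaleDl.
Qed.

HB.instance Definition _ := GRing.Zmodule_isLmodule.Build F presented_lie
  pl_scaleA pl_scale1 pl_scaleDr pl_scaleDl.

Lemma pl_piZ a (x : lie_term F G) : a *: (pi x : L) = pi (LScale a x).
Proof. exact: pl_scaleE. Qed.

Fact pl_brDl x y z : pl_br (x + y) z = pl_br x z + pl_br y z.
Proof.
elim/quotW: x => x; elim/quotW: y => y; elim/quotW: z => z.
by rewrite ?pl_pi0 !(pl_piD, plE); apply/lie_piP; exact: lc_brDl.
Qed.
Fact pl_brDr x y z : pl_br x (y + z) = pl_br x y + pl_br x z.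
Proof.
elim/quotW: x => x; elim/quotW: y => y; elim/quotW: z => z.
by rewrite ?pl_pi0 !(pl_piD, plE); apply/lie_piP; exact: lc_brDr.
Qed.
Fact pl_brZl (a : F) (x y : L) : pl_br (a *: x) y = a *: pl_br x y.
Proof.
elim/quotW: x => x; elim/quotW: y => y.
by rewrite !(pl_piZ, plE); apply/lie_piP; exact: lc_brZl.
Qed.
Fact pl_brZr (a : F) (x y : L) : pl_br x (a *: y) = a *: pl_br x y.
Proof.
elim/quotW: x => x; elim/quotW: y => y.
by rewrite !(pl_piZ, plE); apply/lie_piP; exact: lc_brZr.
Qed.
Fact pl_brxx x : pl_br x x = 0.
Proof. by elim/quotW: x => x; rewrite plE pl_pi0; apply/lie_piP; exact: lc_brxx. Qed.
Fact pl_jacobi x y z :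
  pl_br x (pl_br y z) + pl_br y (pl_br z x) + pl_br z (pl_br x y) = 0.
Proof.
elim/quotW: x => x; elim/quotW: y => y; elim/quotW: z => z.
by rewrite ?pl_pi0 !(pl_piD, plE); apply/lie_piP; exact: lc_jacobi.
Qed.

HB.instance Definition _ := Lmodule_isLieAlgebra.Build F presented_lie
  pl_brDl pl_brDr pl_brZl pl_brZr pl_brxx pl_jacobi.

Definition lie_gen (g : G) : presented_lie := pi (LGen g).

End PresentedLie.

(* The universal enveloping algebra of L: the associative unital F-algebra
   generated by L subject to the linear relations of L and to
   [x, y] = x y - y x, obtained from formal expressions as above. *)
Inductive env_term (F : Type) (L : Type) : Type :=
| EGen of L
| EZero
| EOne
| EAdd of env_term F L & env_term F L
| EOpp of env_term F L
| EScale of F & env_term F L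
| EMul of env_term F L & env_term F L.

Arguments EGen {F L}.
Arguments EZero {F L}.
Arguments EOne {F L}.

HB.instance Definition _ F L := gen_eqMixin (env_term F L).
HB.instance Definition _ F L := gen_choiceMixin (env_term F L).

Declare Scope env_term_scope.
Delimit Scope env_term_scope with ET.
Bind Scope env_term_scope with env_term.
Notation "0" := EZero : env_term_scope.
Notation "1" := EOne : env_term_scope.
Notation "x + y" := (EAdd x y) : env_term_scope.
Notation "- x" := (EOpp x) : env_term_scope.
Notation "x - y" := (EAdd x (EOpp y)) : env_term_scope.
Notation "a *: x" := (EScale a%R x) : env_term_scope.
Notation "x * y" := (EMul x y) : env_term_scope.

Section Enveloping.
Variables (F : fieldType) (L : lieAlgType F).

Inductive env_cong : env_term F L -> env_term F L -> Prop :=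
| ec_genD x y : env_cong (EGen (x + y)%R) (EGen x + EGen y)
| ec_genZ a x : env_cong (EGen (a *: x)%R) (a *: EGen x)
| ec_genbr x y :
    env_cong (EGen (lie_br x y)) (EGen x * EGen y - EGen y * EGen x)
| ec_refl x : env_cong x x
| ec_sym x y : env_cong x y -> env_cong y x
| ec_trans x y z : env_cong x y -> env_cong y z -> env_cong x z
| ec_add x x' y y' :
    env_cong x x' -> env_cong y y' -> env_cong (x + y) (x' + y')
| ec_opp x x' : env_cong x x' -> env_cong (- x) (- x')
| ec_scale a x x' : env_cong x x' -> env_cong (a *: x) (a *: x')
| ec_mul x x' y y' :
    env_cong x x' -> env_cong y y' -> env_cong (x * y) (x' * y')
| ec_addA x y z : env_cong (x + (y + z)) (x + y + z)
| ec_addC x y : env_cong (x + y) (y + x)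
| ec_add0 x : env_cong (0 + x) x
| ec_addN x : env_cong (- x + x) 0
| ec_mulA x y z : env_cong (x * (y * z)) (x * y * z)
| ec_mul1l x : env_cong (1 * x) x
| ec_mul1r x : env_cong (x * 1) x
| ec_mulDl x y z : env_cong ((x + y) * z) (x * z + y * z)
| ec_mulDr x y z : env_cong (x * (y + z)) (x * y + x * z)
| ec_scaleA a b x : env_cong (a *: (b *: x)) ((a * b) *: x)
| ec_scale1 x : env_cong (1 *: x) x
| ec_scaleDr a x y : env_cong (a *: (x + y)) (a *: x + a *: y)
| ec_scaleDl a b x : env_cong ((a + b) *: x) (a *: x + b *: x)
| ec_scaleAl a x y : env_cong (a *: (x * y)) ((a *: x) * y)
| ec_scaleAr a x y : env_cong (a *: (x * y)) (x * (a *: y)).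

Definition env_eqv : rel (env_term F L) := fun x y => `[< env_cong x y >].

Lemma env_eqv_equiv : equiv_class_of env_eqv.
Proof.
split=> [x|x y|y x z].
- by apply/asboolP; exact: ec_refl.
- by apply/idP/idP => /asboolP h; apply/asboolP; exact: ec_sym.
- by move=> /asboolP h /asboolP k; apply/asboolP; exact: ec_trans h k.
Qed.

Canonical env_eqv_canonical := EquivRelPack env_eqv_equiv.
Canonical env_eqv_encModRel := defaultEncModRel env_eqv.

Definition enveloping := {eq_quot env_eqv}.
HB.instance Definition _ : EqQuotient _ env_eqv enveloping :=
  EqQuotient.on enveloping.
HB.instance Definition _ := Choice.on enveloping.

Local Notation U := enveloping.
Local Notation pi := (\pi_U).

Lemma env_piP x y : pi x = pi y <-> env_cong x y.
Proof.
split=> [/eqmodP/asboolP //|h]; apply/eqmodP; exact/asboolP.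
Qed.

Lemma env_reprK x : env_cong (repr (pi x)) x.
Proof. by apply/env_piP; rewrite reprK. Qed.

Definition env_zero : U := lift_cst U EZero.
Definition env_one : U := lift_cst U EOne.
Definition env_add := lift_op2 U (@EAdd F L).
Definition env_opp := lift_op1 U (@EOpp F L).
Definition env_scale (a : F) := lift_op1 U (EScale a).
Definition env_mul := lift_op2 U (@EMul F L).

Lemma env_addE x y : env_add (pi x) (pi y) = pi (EAdd x y).
Proof. by rewrite /env_add -lock; apply/env_piP; apply: ec_add; exact: env_reprK. Qed.
Lemma env_oppE x : env_opp (pi x) = pi (EOpp x).
Proof. by rewrite /env_opp -lock; apply/env_piP; apply: ec_opp; exact: env_reprK. Qed.
Lemma env_scaleE a x : env_scale a (pi x) = pi (EScale a x).
Proof. by rewrite /env_scale -lock; apply/env_piP; apply: ec_scale; exact: env_reprK. Qed.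
Lemma env_mulE x y : env_mul (pi x) (pi y) = pi (EMul x y).
Proof. by rewrite /env_mul -lock; apply/env_piP; apply: ec_mul; exact: env_reprK. Qed.

Lemma env_zeroE : env_zero = pi EZero.
Proof. by rewrite /env_zero -lock. Qed.
Lemma env_oneE : env_one = pi EOne.
Proof. by rewrite /env_one -lock. Qed.

Let envE := (env_zeroE, env_oneE, env_addE, env_oppE, env_scaleE, env_mulE).

Fact env_addA : associative env_add.
Proof.
elim/quotW=> x; elim/quotW=> y; elim/quotW=> z.
by rewrite !envE; apply/env_piP; exact: ec_addA.
Qed.
Fact env_addC : commutative env_add.
Proof.
by elim/quotW=> x; elim/quotW=> y; rewrite !envE; apply/env_piP; exact: ec_addC.
Qed.
Fact env_add0 : left_id env_zero env_add.
Proof. by elim/quotW=> x; rewrite !envE; apply/env_piP; exact: ec_add0. Qed.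
Fact env_addN : left_inverse env_zero env_opp env_add.
Proof. by elim/quotW=> x; rewrite !envE; apply/env_piP; exact: ec_addN. Qed.
Fact env_mulA : associative env_mul.
Proof.
elim/quotW=> x; elim/quotW=> y; elim/quotW=> z.
by rewrite !envE; apply/env_piP; exact: ec_mulA.
Qed.
Fact env_mul1l : left_id env_one env_mul.
Proof. by elim/quotW=> x; rewrite !envE; apply/env_piP; exact: ec_mul1l. Qed.
Fact env_mul1r : right_id env_one env_mul.
Proof. by elim/quotW=> x; rewrite !envE; apply/env_piP; exact: ec_mul1r. Qed.
Fact env_mulDl : left_distributive env_mul env_add.
Proof.
elim/quotW=> x; elim/quotW=> y; elim/quotW=> z.
by rewrite !envE; apply/env_piP; exact: ec_mulDl.
Qed.
Fact env_mulDr : right_distributive env_mul env_add.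
Proof.
elim/quotW=> x; elim/quotW=> y; elim/quotW=> z.
by rewrite !envE; apply/env_piP; exact: ec_mulDr.
Qed.

(* The augmentation, used only to see that 1 != 0. *)
Fixpoint env_aug (x : env_term F L) : F :=
  match x with
  | EGen _ | EZero => 0
  | EOne => 1
  | EAdd x y => env_aug x + env_aug y
  | EOpp x => - env_aug x
  | EScale a x => a * env_aug x
  | EMul x y => env_aug x * env_aug y
  end.

Lemma env_aug_cong x y : env_cong x y -> env_aug x = env_aug y.
Proof.
elim=> //=; try by move=> *; congruence.
- by rewrite addr0.
- by move=> *; rewrite mulr0.
- by move=> *; rewrite mulr0 subr0.
- by move=> *; rewrite addrA.
- by move=> *; rewrite addrC.
- by move=> *; rewrite add0r.
- by move=> *; rewrite addNr.
- by move=> *; rewrite mulrA.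
- by move=> *; rewrite mul1r.
- by move=> *; rewrite mulr1.
- by move=> *; rewrite mulrDl.
- by move=> *; rewrite mulrDr.
- by move=> *; rewrite mulrA.
- by move=> *; rewrite mul1r.
- by move=> *; rewrite mulrDr.
- by move=> *; rewrite mulrDl.
- by move=> *; rewrite mulrA.
- by move=> *; rewrite mulrCA.
Qed.

Fact env_one_neq0 : env_one != env_zero.
Proof.
rewrite !envE; apply/eqP => /env_piP /env_aug_cong /= /eqP; by rewrite oner_eq0.
Qed.

HB.instance Definition _ := GRing.isNzRing.Build enveloping
  env_addA env_addC env_add0 env_addN env_mulA env_mul1l env_mul1r
  env_mulDl env_mulDr env_one_neq0.

Lemma env_piD (x y : env_term F L) : (pi x : U) + pi y = pi (EAdd x y).
Proof. exact: env_addE. Qed.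
Lemma env_piM (x y : env_term F L) : (pi x : U) * pi y = pi (EMul x y).
Proof. exact: env_mulE. Qed.

Fact env_scaleA a b x : env_scale a (env_scale b x) = env_scale (a * b) x.
Proof.
by elim/quotW: x => x; rewrite !envE; apply/env_piP; exact: ec_scaleA.
Qed.
Fact env_scale1 : left_id 1 env_scale.
Proof. by elim/quotW=> x; rewrite !envE; apply/env_piP; exact: ec_scale1. Qed.
Fact env_scaleDr : right_distributive env_scale +%R.
Proof.
move=> a; elim/quotW=> x; elim/quotW=> y.
by rewrite !(env_piD, envE); apply/env_piP; exact: ec_scaleDr.
Qed.
Fact env_scaleDl x : {morph env_scale^~ x : a b / a + b}.
Proof.
move=> a b /=; elim/quotW: x => x.
by rewrite !(env_piD, envE); apply/env_piP; exact: ec_scaleDl.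
Qed.

HB.instance Definition _ := GRing.Zmodule_isLmodule.Build F enveloping
  env_scaleA env_scale1 env_scaleDr env_scaleDl.

Lemma env_piZ a (x : env_term F L) : a *: (pi x : U) = pi (EScale a x).
Proof. exact: env_scaleE. Qed.

Fact env_scaleAl (a : F) (x y : U) : a *: (x * y) = (a *: x) * y.
Proof.
elim/quotW: x => x; elim/quotW: y => y.
by rewrite !(env_piM, env_piZ); apply/env_piP; exact: ec_scaleAl.
Qed.
HB.instance Definition _ := GRing.Lmodule_isLalgebra.Build F enveloping
  env_scaleAl.

Fact env_scaleAr (a : F) (x y : U) : a *: (x * y) = x * (a *: y).
Proof.
elim/quotW: x => x; elim/quotW: y => y.
by rewrite !(env_piM, env_piZ); apply/env_piP; exact: ec_scaleAr.
Qed.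
HB.instance Definition _ := GRing.Lalgebra_isAlgebra.Build F enveloping
  env_scaleAr.

Definition env_gen (x : L) : enveloping := pi (EGen x).

End Enveloping.

Section Modules.
Variables (A : pzRingType) (V : lmodType A).

Definition span_submod (S : set V) : {pred V} :=
  fun v => `[< forall N : {pred V},
                 submod_closed N -> (forall x, S x -> x \in N) -> v \in N >].

Fact span_submod_closed S : submod_closed (span_submod S).
Proof.
split=> [|a x y /asboolP hx /asboolP hy]; apply/asboolP => N Nc SN.
  by case: Nc.
by case: (Nc) => _; apply; [exact: hx | exact: hy].
Qed.
HB.instance Definition _ S :=
  GRing.isSubmodClosed.Build A V (span_submod S) (span_submod_closed S).

Definition maximal_submod (N : {pred V}) : Prop :=
  [/\ submod_closed N, exists v, v \notin N &
      forall N' : {pred V}, submod_closed N' -> {subset N <= N'} ->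
        N' =i N \/ forall v, v \in N'].

Definition the_maximal_submod (N : {pred V}) : Prop :=
  maximal_submod N /\ forall N', maximal_submod N' -> N' =i N.

(* The unique maximal proper submodule of V if there is one (and V itself
   otherwise). *)
Definition rad_submod : {pred V} :=
  fun v => `[< forall N, the_maximal_submod N -> v \in N >].

Fact rad_submod_closed : submod_closed rad_submod.
Proof.
split=> [|a x y /asboolP hx /asboolP hy]; apply/asboolP => N mN.
  by case: mN => [[[]]].
by case: (mN) => [[[_ + _ _]] _]; apply; [exact: hx | exact: hy].
Qed.
HB.instance Definition _ :=
  GRing.isSubmodClosed.Build A V rad_submod rad_submod_closed.

Definition simple_module : Prop :=
  (exists v : V, v != 0) /\
  forall N : {pred V}, submod_closed N ->
    (forall v, v \in N -> v = 0) \/ (forall v, v \in N).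

Definition isomorphic_modules (W : lmodType A) : Prop :=
  exists f : {linear V -> W}, bijective f.

End Modules.

Arguments rad_submod {A} V.

Section QuotientModule.
Variables (A : pzRingType) (V : lmodType A) (N : submodClosed V).

Definition submod_pred : {pred V} := N.
HB.instance Definition _ := GRing.isZmodClosed.Build V submod_pred
  (GRing.submod_closedB (submodClosedP N)).

Definition quot_module := Quotient.quot submod_pred.
HB.instance Definition _ := GRing.Zmodule.on quot_module.

Local Notation W := quot_module.
Definition quot_proj (v : V) : W := \pi_(Quotient.quot submod_pred) v.
Definition quot_scale (a : A) (x : W) : W :=
  quot_proj (a *: repr (x : Quotient.quot submod_pred)).

Lemma quot_projP x y : quot_proj x = quot_proj y <-> x - y \in (N : {pred V}).
Proof. by rewrite (Quotient.idealrBE submod_pred); split=> /eqP. Qed.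

Lemma quot_projW (P : W -> Prop) : (forall v, P (quot_proj v)) -> forall x, P x.
Proof. by move=> h; exact: quotW. Qed.

Lemma quot_projD : {morph quot_proj : x y / x + y}.
Proof. by move=> x y; rewrite /quot_proj [LHS]raddfD. Qed.

Lemma quot_scaleE a v : quot_scale a (quot_proj v) = quot_proj (a *: v).
Proof.
apply/quot_projP; rewrite -scalerBr; apply: rpredZ; apply/quot_projP.
exact: (reprK (quot_proj v : Quotient.quot submod_pred)).
Qed.

Fact quot_scaleA a b x : quot_scale a (quot_scale b x) = quot_scale (a * b) x.
Proof. by elim/quot_projW: x => x; rewrite !quot_scaleE scalerA. Qed.
Fact quot_scale1 : left_id 1 quot_scale.
Proof. by elim/quot_projW=> x; rewrite !quot_scaleE scale1r. Qed.
Fact quot_scaleDr : right_distributive quot_scale +%R.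
Proof.
move=> a; elim/quot_projW=> x; elim/quot_projW=> y.
by rewrite -quot_projD !quot_scaleE scalerDr quot_projD.
Qed.
Fact quot_scaleDl x : {morph quot_scale^~ x : a b / a + b}.
Proof.
by move=> a b; elim/quot_projW: x => x; rewrite !quot_scaleE scalerDl quot_projD.
Qed.
HB.instance Definition _ := GRing.Zmodule_isLmodule.Build A quot_module
  quot_scaleA quot_scale1 quot_scaleDr quot_scaleDl.

End QuotientModule.

(* An A-module V is a vector space over F through c |-> c%:A. *)
Definition finite_dimensional (F : fieldType) (A : algType F) (V : lmodType A) :
    Prop :=
  exists n (e : 'I_n -> V), forall v, exists c : 'I_n -> F,
    v = \sum_i (c i)%:A *: e i.

Section DeformedCurrent.
Variable m : nat.

(* The 1-based index i in {1, .., m-1} is represented by i - 1 : 'I_m.-1, and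
   likewise for j in {1, .., m}. *)
Inductive gl_gen : Type :=
| GX of bool & 'I_m.-1 & nat    (* X^+_{i,t} for true, X^-_{i,t} for false *)
| GI of 'I_m & nat.

Definition ord_this (i : 'I_m.-1) : 'I_m := widen_ord (leq_pred m) i.

Fact ord_next_subproof (i : 'I_m.-1) : (i.+1 < m)%N.
Proof. by rewrite -ltn_predRL. Qed.
Definition ord_next (i : 'I_m.-1) : 'I_m := Ordinal (ord_next_subproof i).

Definition adjacent (i j : 'I_m.-1) : bool :=
  (j == i.+1 :> nat) || (i == j.+1 :> nat).

Section Relations.
Variables (F : fieldType) (Q : 'I_m.-1 -> F).

Definition tX b i t : lie_term F gl_gen := LGen (GX b i t).
Definition tI j t : lie_term F gl_gen := LGen (GI j t).
Definition tJ i t : lie_term F gl_gen :=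
  (tI (ord_this i) t - tI (ord_next i) t)%LT.

Definition cartan' (j : 'I_m) (i : 'I_m.-1) : F :=
  if j == i :> nat then 1 else if j == i.+1 :> nat then -1 else 0.

Definition pm (b : bool) : F := if b then 1 else -1.

Inductive gl_rel : lie_term F gl_gen -> lie_term F gl_gen -> Prop :=
| gl_L1 i j s t : gl_rel [br tI i s, tI j t] 0
| gl_L2 b j i s t :
    gl_rel [br tI j s, tX b i t] ((pm b * cartan' j i) *: tX b i (s + t))
| gl_L3 i j s t :
    gl_rel [br tX true i t, tX false j s]
           (if i == j then (tJ i (s + t) - Q i *: tJ i (s + t).+1)%LT else 0%LT)
| gl_L4 b i j s t : ~~ adjacent i j -> gl_rel [br tX b i t, tX b j s] 0
| gl_L5 b i j s t : adjacent i j ->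
    gl_rel [br tX b i t.+1, tX b j s] [br tX b i t, tX b j s.+1]
| gl_L6 b i j s t u : adjacent i j ->
    gl_rel [br tX b i s, [br tX b i t, tX b j u]] 0.

Definition gl_lie : lieAlgType F := presented_lie gl_rel.
Definition Ugl : algType F := enveloping gl_lie.

Definition UX b i t : Ugl := env_gen (lie_gen gl_rel (GX b i t)).
Definition UI j t : Ugl := env_gen (lie_gen gl_rel (GI j t)).

Definition highest_weight_module (u : 'I_m -> nat -> F) (V : lmodType Ugl) :
    Prop :=
  exists v0 : V,
    [/\ v0 != 0,
        forall v, v \in span_submod [set v0]%classic,
        forall i t, UX true i t *: v0 = 0 &
        forall j t, UI j t *: v0 = (u j t)%:A *: v0].

(* Ugl^o is Ugl as a left module over itself: its submodules are the left
   ideals. *)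
Definition verma_rels (u : 'I_m -> nat -> F) : set Ugl^o :=
  fun a => (exists i t, a = UX true i t) \/
           (exists j t, a = UI j t - (u j t)%:A).

Definition verma (u : 'I_m -> nat -> F) : lmodType Ugl :=
  quot_module (span_submod (verma_rels u)).

Definition simple_hw (u : 'I_m -> nat -> F) : lmodType Ugl :=
  quot_module (rad_submod (verma u)).

End Relations.
End DeformedCurrent.

Section ParameterSets.
Variable F : closedFieldType.

Definition Bset (q : F) : set F :=
  (if q == 0 then [set 0] else [set: F])%classic.

Definition monic_set (q : F) : set {poly F} :=
  [set p | p \is monic /\ (q != 0 -> ~~ root p q^-1)]%classic.

(* The roots of p with multiplicity, in an arbitrary order. *)
Definition roots_of (p : {poly F}) : seq F := sval (closed_field_poly_normal p).

Variable m : nat.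

(* ((phi_i, beta_i))_i and h *)
Definition parameters : Type := (('I_m.-1 -> {poly F} * F) * (nat -> F))%type.

Definition parameter_set (Q : 'I_m.-1 -> F) : set parameters :=
  fun p => forall i, monic_set (Q i) (p.1 i).1 /\ Bset (Q i) (p.1 i).2.

Definition u_weight (Q : 'I_m.-1 -> F) (pb : 'I_m.-1 -> {poly F} * F)
    (i : 'I_m.-1) (t : nat) : F :=
  let: (phi, beta) := pb i in
  if t == 0%N then (size phi).-1%:R + beta
  else if Q i == 0 then \sum_(g <- roots_of phi) g ^+ t
  else \sum_(g <- roots_of phi) g ^+ t + (Q i) ^- t * beta.

(* The sum is empty for the last index j, giving h_t. *)
Definition ut_weight (Q : 'I_m.-1 -> F) (p : parameters) (j : 'I_m) (t : nat) :
    F :=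
  \sum_(k < m.-1 | (j <= k)%N) u_weight Q p.1 k t + p.2 t.

End ParameterSets.

(* Main.v *)
Require Import Defs.
From HB Require Import structures.
From mathcomp Require Import all_boot all_order all_algebra perm ssrAC.
From mathcomp Require Import ring_quotient.
From mathcomp Require Import boolp classical_sets reals complex.
From mathcomp Require Import mxtens zify ring.

(** The argument splits along the three claims, which meet in the notion of a
highest weight vector.

The element [grading], a combination of the I_{j,0}, satisfies
[grading, X^+-] = +-X^+-.  A highest weight module is spanned by words in the
X^- applied to v0, and a word of length l has eigenvalue lambda - l.  Hence
V = F v0 + V', where V' ([off_weight]) consists of the vectors killed by some
p(grading) with p(lambda) != 0, and a proper submodule, being stable under
grading, lies in V'.  So there is a largest proper submodule
([radical_maximal]), a simple highest weight module is determined by its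
weight ([hw_simple_iso]), and the weight is determined by the module
([hw_iso_weight]): an isomorphism preserves the eigenvalues of grading, which
confines a highest weight vector to the line F v0.

Existence.  It suffices to produce one finite dimensional module with a vector
of the prescribed highest weight, because that vector proves the Verma module
nonzero and L(u) is a subquotient of the module ([realizable_simple_hw]).
Weights add up under tensor products.  The evaluation
at g of the k-th fundamental representation, found inside the exterior
algebra, contributes g^t to u_{k,t}; a one-dimensional module contributes the
Q_k^{-t} beta_k and the h_t.

Completeness.  In a finite dimensional simple module a joint eigenvector of the
I_{j,t}, taken in an eigenspace of grading for an eigenvalue c such that
c + 1 is not an eigenvalue, is a highest weight vector ([fd_hw_vector]).  To
identify its weight, fix i and write q = 1 - Q_i x.  For a polynomial p, the
elements E = X^+_{i,0}, X_n = X^-_i(p^(n+1) q^n), H_n = J_i((p q)^(n+1)) satisfy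
[E, X_n] = H_n and [H_n, X_k] = -2 X_{n+k+1}.  If H_n v0 = h_n v0 and e_s is the
sequence that Newton's identities attach to the power sums h_n, then E^s X_0^s
sends v0 to s!^2 e_s v0.  Finite dimensionality kills X_0^s v0 for large s, so
sum_s e_s z^s is a polynomial; factoring it over the algebraically closed field
gives h_n = sum_y y^(n+1) with nonzero y ([current_sl2_weights]).  When
Q_i != 0, the choice p = 1 settles everything, since q generates F[x].  When
Q_i = 0, p = x gives the power sums of positive exponent, and p = x + 1 shows
that the value at t = 0 exceeds the number of nonzero roots by a natural
number, the multiplicity of the root 0.

Uniqueness.  Equal weights have equal power sums, and Lagrange interpolation
recovers from them the multiplicity of every root, then beta and h
([ut_weight_inj]). *)

Set Implicit Arguments.
Unset Strict Implicit.
Unset Printing Implicit Defensive.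
Import GRing.Theory Num.Theory.
Local Open Scope ring_scope.
Local Open Scope quotient_scope.

(** * Generators and relations in the enveloping algebra *)

Section FieldScalars.
Variables (F : fieldType) (A : algType F) (V : lmodType A).

Lemma fscale_comm (x : A) (c : F) (v : V) : x *: (c%:A *: v) = c%:A *: (x *: v).
Proof. by rewrite !scalerA mulr_algr mulr_algl. Qed.

Lemma fscaleA (a b : F) (v : V) : a%:A *: (b%:A *: v) = (a * b)%:A *: v.
Proof. by rewrite scalerA mulr_algl scalerA. Qed.

Lemma fscaleZ (a : F) (x : A) (v : V) : (a *: x) *: v = a%:A *: (x *: v).
Proof. by rewrite scalerA mulr_algl. Qed.

Lemma fscaleDl (a b : F) (v : V) : (a + b)%:A *: v = a%:A *: v + b%:A *: v.
Proof. by rewrite !scalerDl. Qed.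

Lemma fscaleBl (a b : F) (v : V) : (a - b)%:A *: v = a%:A *: v - b%:A *: v.
Proof. by rewrite !scalerBl. Qed.

End FieldScalars.

Section Relations.
Variables (m : nat) (F : fieldType) (Q : 'I_m.-1 -> F).
Local Notation U := (Ugl Q).
Local Notation term := (lie_term F (gl_gen m)).

(** Working with formal Lie expressions lets each defining relation be read off
as an identity between products of generators. *)
Definition in_U (x : term) : U := env_gen (\pi_(gl_lie Q) x).

Lemma env_genD (L : lieAlgType F) (x y : L) :
  env_gen (x + y) = env_gen x + env_gen y.
Proof. by rewrite /env_gen env_piD; apply/env_piP; exact: ec_genD. Qed.

Lemma env_genZ (L : lieAlgType F) (a : F) (x : L) :
  env_gen (a *: x) = a *: env_gen x.
Proof. by rewrite /env_gen env_piZ; apply/env_piP; exact: ec_genZ. Qed.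

Lemma env_genN (L : lieAlgType F) (x : L) : env_gen (- x) = - env_gen x.
Proof. by rewrite -scaleN1r env_genZ scaleN1r. Qed.

Lemma env_gen0 (L : lieAlgType F) : env_gen (0 : L) = 0.
Proof. by rewrite -(scale0r (0 : L)) env_genZ scale0r. Qed.

Lemma env_gen_br (L : lieAlgType F) (x y : L) :
  env_gen (lie_br x y) = env_gen x * env_gen y - env_gen y * env_gen x.
Proof.
have eN (t : env_term F L) : - (\pi_(enveloping L) t) = \pi_(enveloping L) (EOpp t).
  exact: env_oppE.
by rewrite /env_gen !env_piM eN env_piD; apply/env_piP; exact: ec_genbr.
Qed.

Lemma in_U_add x y : in_U (x + y)%LT = in_U x + in_U y.
Proof. by rewrite /in_U -env_genD pl_piD. Qed.
Lemma in_U_scale a x : in_U (a *: x)%LT = a *: in_U x.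
Proof. by rewrite /in_U -env_genZ pl_piZ. Qed.
Lemma in_U_opp x : in_U (- x)%LT = - in_U x.
Proof. by rewrite /in_U -env_genN [- _]pl_oppE. Qed.
Lemma in_U_zero : in_U 0%LT = 0.
Proof. by rewrite /in_U -pl_pi0 env_gen0. Qed.
Lemma in_U_br x y : in_U [br x, y]%LT = in_U x * in_U y - in_U y * in_U x.
Proof. by rewrite /in_U -env_gen_br [lie_br _ _]pl_brE. Qed.

Lemma in_U_rel x y : gl_rel Q x y -> in_U x = in_U y.
Proof.
by move=> h; rewrite /in_U; congr env_gen; apply/lie_piP; exact: lc_rel.
Qed.

Lemma in_U_X b i t : in_U (tX F b i t) = UX Q b i t.
Proof. by []. Qed.
Lemma in_U_I j t : in_U (tI F j t) = UI Q j t.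
Proof. by []. Qed.

Definition UJ (i : 'I_m.-1) t : U :=
  UI Q (ord_this i) t - UI Q (ord_next i) t.

Lemma UI_comm i j s t : UI Q i s * UI Q j t = UI Q j t * UI Q i s.
Proof.
apply/eqP; rewrite -subr_eq0 -!in_U_I -in_U_br.
by rewrite (in_U_rel (gl_L1 Q i j s t)) in_U_zero.
Qed.

Lemma UI_UX b j i s t :
  UI Q j s * UX Q b i t =
  UX Q b i t * UI Q j s + (pm F b * cartan' F j i) *: UX Q b i (s + t).
Proof.
apply/eqP; rewrite addrC -subr_eq -!in_U_I -!in_U_X -in_U_br.
by rewrite (in_U_rel (gl_L2 Q b j i s t)) in_U_scale.
Qed.

Lemma UXX i j s t :
  UX Q true i t * UX Q false j s =
  UX Q false j s * UX Q true i t +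
  (if i == j then UJ i (s + t) - Q i *: UJ i (s + t).+1 else 0).
Proof.
apply/eqP; rewrite addrC -subr_eq -!in_U_X -in_U_br.
rewrite (in_U_rel (gl_L3 Q i j s t)); case: (i =P j) => _; last by rewrite in_U_zero.
by rewrite in_U_add in_U_opp in_U_scale !in_U_add !in_U_opp.
Qed.

Lemma UX_comm b i s t : UX Q b i t * UX Q b i s = UX Q b i s * UX Q b i t.
Proof.
have nadj : ~~ adjacent i i by rewrite /adjacent ltn_eqF.
apply/eqP; rewrite -subr_eq0 -!in_U_X -in_U_br.
by rewrite (in_U_rel (gl_L4 Q b s t nadj)) in_U_zero.
Qed.

(** The enveloping algebra is generated by the X and the I alone: brackets of
Lie elements become commutators of products. *)
Lemma Ugl_ind (P : U -> Prop) :
  P 1 -> (forall x y, P x -> P y -> P (x + y)) ->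
  (forall c x, P x -> P (c *: x)) -> (forall x y, P x -> P y -> P (x * y)) ->
  (forall b i t, P (UX Q b i t)) -> (forall j t, P (UI Q j t)) ->
  forall x, P x.
Proof.
move=> P1 PD PZ PM PX PI.
have P0 : P 0 by rewrite -(scale0r 1); exact: PZ.
have PN x : P x -> P (- x) by rewrite -scaleN1r; exact: PZ.
have PL (t : term) : P (in_U t).
  elim: t => [[b i t|j t]|| x Px y Py|x Px|a x Px|x Px y Py].
  - exact: PX.
  - exact: PI.
  - by rewrite in_U_zero.
  - by rewrite in_U_add; exact: PD.
  - by rewrite in_U_opp; exact: PN.
  - by rewrite in_U_scale; exact: PZ.
  - by rewrite in_U_br; apply: PD; [exact: PM | exact/PN/PM].
elim/quotW => t; elim: t => [l|||x Px y Py|x Px|a x Px|x Px y Py].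
- by have := PL (repr l); rewrite /in_U reprK.
- by rewrite -env_zeroE.
- by rewrite -env_oneE.
- by rewrite -env_piD; exact: PD.
- by rewrite -env_oppE; exact: PN.
- by rewrite -env_piZ; exact: PZ.
- by rewrite -env_piM; exact: PM.
Qed.

(** Submodules are recognised on generators; this is how the span of a family
of vectors is shown to be everything. *)
Lemma generators_submod (V : lmodType U) (N : V -> Prop) :
  N 0 -> (forall v w, N v -> N w -> N (v + w)) ->
  (forall c v, N v -> N (c%:A *: v)) ->
  (forall b i t v, N v -> N (UX Q b i t *: v)) ->
  (forall j t v, N v -> N (UI Q j t *: v)) ->
  forall x v, N v -> N (x *: v).
Proof.
move=> N0 ND NZ NX NI; apply: Ugl_ind => //.
- by move=> v; rewrite scale1r.
- by move=> x y Nx Ny v Nv; rewrite scalerDl; apply: ND; [exact: Nx|exact: Ny].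
- by move=> c x Nx v Nv; rewrite fscaleZ; exact/NZ/Nx.
- by move=> x y Nx Ny v Nv; rewrite -scalerA; exact/Nx/Ny.
Qed.

End Relations.

(** * Highest weight modules and their largest proper submodule *)

Section HighestWeight.
Variables (m : nat) (F : numFieldType) (Q : 'I_m.-1 -> F).
Local Notation U := (Ugl Q).

(** The coefficients are chosen so that consecutive ones differ by one, whence
every X^+ raises the eigenvalue of this element by one and every X^- lowers it
by one: a single operator replaces the weight lattice. *)
Definition grading : U := \sum_(j < m) (- j%:R) *: UI Q j 0.

Definition grading_weight (u : 'I_m -> nat -> F) : F :=
  \sum_(j < m) (- j%:R) * u j 0.

Lemma cartan'E (j : 'I_m) (i : 'I_m.-1) :
  cartan' F j i = (j == ord_this i)%:R - (j == ord_next i)%:R.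
Proof.
rewrite /cartan' -!val_eqE /=; case: eqP => [->|_]; first by rewrite ltn_eqF // subr0.
by case: eqP => _; rewrite ?subr0 // sub0r.
Qed.

Lemma grading_UX b i t :
  grading * UX Q b i t = UX Q b i t * grading + pm F b *: UX Q b i t.
Proof.
rewrite /grading mulr_suml mulr_sumr.
under eq_bigr do rewrite -scalerAl UI_UX scalerDr scalerAr scalerA.
rewrite big_split /=; congr (_ + _); rewrite -scaler_suml; congr (_ *: _).
under eq_bigr do rewrite mulrCA cartan'E mulrBr.
rewrite -mulr_sumr sumrB (bigD1 (ord_this i)) //= [X in _ - X](bigD1 (ord_next i)) //=.
rewrite !big1 => [|j /negbTE ->|j /negbTE ->]; try by rewrite mulr0.
rewrite !eqxx !mulr1 !addr0 opprK -[i.+1]addn1 natrD addrA addNr add0r mulr1 //.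
Qed.

Lemma grading_UI j t : grading * UI Q j t = UI Q j t * grading.
Proof.
rewrite /grading mulr_suml mulr_sumr; apply: eq_bigr => k _.
by rewrite -scalerAl -scalerAr UI_comm.
Qed.

Section Vector.
Variables (V : lmodType U) (u : 'I_m -> nat -> F) (v0 : V).

Definition hw_vector :=
  (forall i t, UX Q true i t *: v0 = 0) /\
  (forall j t, UI Q j t *: v0 = (u j t)%:A *: v0).

Local Notation lam := (grading_weight u).

Lemma horner_eigen (x : U) (c : F) (v : V) p :
  x *: v = c%:A *: v -> horner_alg x p *: v = (p.[c])%:A *: v.
Proof.
move=> xv; elim/poly_ind: p => [|p a IH].
  by rewrite rmorph0 horner0 !scale0r.
rewrite rmorphD rmorphM /= horner_algX horner_algC scalerDl -scalerA xv.
by rewrite fscale_comm IH fscaleA -scalerDl -scalerDl hornerMXaddC mulrC.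
Qed.

(** The vectors without component in the generalized eigenspace of v0, a
condition that makes sense before V is known to decompose. *)
Definition off_weight (v : V) :=
  exists2 p : {poly F}, p.[lam] != 0 & horner_alg grading p *: v = 0.

Lemma off_weight0 : off_weight 0.
Proof. by exists 1; rewrite ?hornerC ?oner_eq0 // scaler0. Qed.

Lemma off_weightD v w : off_weight v -> off_weight w -> off_weight (v + w).
Proof.
move=> [p p0 pv] [q q0 qw]; exists (p * q); first by rewrite hornerM mulf_neq0.
rewrite scalerDr rmorphM /= -[_ *: w]scalerA qw scaler0 addr0.
by rewrite -rmorphM mulrC rmorphM -scalerA pv scaler0.
Qed.

Lemma off_weight_eigen (c : F) v :
  c != lam -> grading *: v = c%:A *: v -> off_weight v.
Proof.
move=> cl gv; exists ('X - c%:P); first by rewrite hornerXsubC subr_eq0 eq_sym.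
by rewrite (horner_eigen _ gv) hornerXsubC subrr !scale0r.
Qed.

(** On the eigenspace of lam, p(grading) is the nonzero scalar p(lam). *)
Lemma off_weight_on v :
  grading *: v = lam%:A *: v -> off_weight v -> v = 0.
Proof.
move=> gv [p p0]; rewrite (horner_eigen _ gv) => pv.
by rewrite -[v]scale1r -[1](scale1r 1) -(mulVf p0) -fscaleA pv scaler0.
Qed.

Hypothesis hw : hw_vector.

Lemma grading_hw : grading *: v0 = lam%:A *: v0.
Proof.
rewrite /grading scaler_suml /grading_weight scaler_suml scaler_suml.
by apply: eq_bigr => j _; rewrite fscaleZ hw.2 fscaleA.
Qed.

Lemma hw_off_weight : v0 != 0 -> ~ off_weight v0.
Proof. by move=> /eqP + h; apply; exact: off_weight_on grading_hw h. Qed.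

(** Level n contains the words of length n in the X^- applied to v0. Each level
is a subspace by construction, so that the straightening of a generator past a
word is a plain induction. *)
Inductive level : nat -> V -> Prop :=
| level_hw : level 0 v0
| level0 n : level n 0
| levelD n v w : level n v -> level n w -> level n (v + w)
| levelZ n c v : level n v -> level n (c%:A *: v)
| level_down n i t v : level n v -> level n.+1 (UX Q false i t *: v).

Lemma level_grading n v : level n v -> grading *: v = (lam - n%:R)%:A *: v.
Proof.
elim=> {n v} [|n|n v w _ IHv _ IHw|n c v _ IH|n i t v _ IH].
- by rewrite subr0 grading_hw.
- by rewrite !scaler0.
- by rewrite !scalerDr IHv IHw.
- by rewrite fscale_comm IH !fscaleA mulrC.
- rewrite scalerA grading_UX scalerDl -scalerA IH fscale_comm [(pm _ _ *: _) *: _]fscaleZ -fscaleDl.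
  by rewrite /pm -[n.+1]addn1 natrD opprD addrA.
Qed.

Lemma level_UI n v j t : level n v -> level n (UI Q j t *: v).
Proof.
elim=> {n v} [|n|n v w _ IHv _ IHw|n c v _ IH|n i s v lv IH].
- by rewrite hw.2; exact/levelZ/level_hw.
- by rewrite scaler0; exact: level0.
- by rewrite scalerDr; exact: levelD.
- by rewrite fscale_comm; exact: levelZ.
- rewrite scalerA UI_UX scalerDl -scalerA fscaleZ.
  by apply: levelD; [exact: level_down | exact/levelZ/level_down].
Qed.

(** X^+ is moved to the right through the word, each commutator with an X^-
being a combination of I's, which preserve levels; at v0 it vanishes. *)
Lemma level_UX_up n v i t : level n v ->
  if n is n'.+1 then level n' (UX Q true i t *: v) else UX Q true i t *: v = 0.
Proof.
elim=> {n v} [|[|n]|[|n] v w _ IHv _ IHw|[|n] c v _ IH|n j s v lv IH].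
- exact: hw.1.
- exact: scaler0.
- by rewrite scaler0; exact: level0.
- by rewrite scalerDr IHv IHw addr0.
- by rewrite scalerDr; exact: levelD.
- by rewrite fscale_comm IH scaler0.
- by rewrite fscale_comm; exact: levelZ.
- rewrite scalerA UXX scalerDl -scalerA; apply: levelD.
    by case: n lv IH => [|n] lv IH; [rewrite IH scaler0; exact: level0 | exact: level_down].
  have lN w : level n w -> level n (- w).
    by move=> lw; rewrite -scaleN1r -[-1]scaleN1r; exact: levelZ.
  have lJ r : level n (UJ Q i r *: v).
    by rewrite /UJ scalerBl; apply: levelD; [|apply: lN]; exact: level_UI.
  case: (i =P j) => _; last by rewrite scale0r; exact: level0.
  by rewrite scalerBl fscaleZ; apply: levelD => //; exact/lN/levelZ.
Qed.

Hypothesis gen : forall v, v \in span_submod [set v0]%classic.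

Lemma hw_generates v : exists x : U, v = x *: v0.
Proof.
pose N : {pred V} := fun v => `[< exists x : U, v = x *: v0 >].
have /asboolP/(_ N) := gen v; case/(_ _ _)/asboolP => [|_ ->|x ->].
- split=> [|a w w' /asboolP[x ->] /asboolP[y ->]]; apply/asboolP.
    by exists 0; rewrite scale0r.
  by exists (a * x + y); rewrite scalerDl scalerA.
- by apply/asboolP; exists 1; rewrite scale1r.
- by exists x.
Qed.

(** The sums of vectors of pure level are stable under the generators and
contain v0. *)
Lemma level_decomposition v :
  exists2 s : seq V, (forall w, w \in s -> exists n, level n w) & v = \sum_(w <- s) w.
Proof.
have [x ->] := hw_generates v; move: x v0 (level_hw).
have stab (f : V -> V) s : (forall v w, f (v + w) = f v + f w) -> f 0 = 0 ->
    (forall n v, level n v -> exists k, level k (f v)) ->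
    (forall w, w \in s -> exists n, level n w) ->
    exists2 s', (forall w, w \in s' -> exists n, level n w) &
      f (\sum_(w <- s) w) = \sum_(w <- s') w.
  move=> fD f0 fl ls; exists (map f s).
    by move=> _ /mapP[w /ls[n lw] ->]; exact: fl lw.
  by rewrite big_map (big_morph f fD f0).
move=> x w0 lw0.
suff : forall x w, (exists2 s, (forall w, w \in s -> exists n, level n w) &
    w = \sum_(w <- s) w) -> exists2 s, (forall w, w \in s -> exists n, level n w) &
    x *: w = \sum_(w <- s) w.
  apply; exists [:: w0]; last by rewrite big_seq1.
  by move=> w; rewrite inE => /eqP ->; exists 0%N.
move=> {w0 lw0 v} x' v'.
apply: (generators_submod (N := fun w => exists2 s,
  (forall w, w \in s -> exists n, level n w) & w = \sum_(w <- s) w)).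
- by exists [::]; rewrite ?big_nil.
- move=> v w [s ls ->] [s' ls' ->]; exists (s ++ s'); last by rewrite big_cat.
  by move=> z; rewrite mem_cat => /orP[/ls|/ls'].
- move=> c v [s ls ->]; apply: stab ls => [v1 v2||n v1 lv1]; rewrite ?scalerDr ?scaler0 //.
  by exists n; exact: levelZ.
- move=> b i t v [s ls ->]; apply: stab ls => [v1 v2||n v1 lv1]; rewrite ?scalerDr ?scaler0 //.
  case: b; last by exists n.+1; exact: level_down.
  have := level_UX_up i t lv1; case: n lv1 => [|n] lv1.
    by move=> ->; exists 0%N; exact: level0.
  by exists n.
- move=> j t v [s ls ->]; apply: stab ls => [v1 v2||n v1 lv1]; rewrite ?scalerDr ?scaler0 //.
  by exists n; exact: level_UI.
Qed.

(** Level 0 is the line of v0, and in characteristic 0 the eigenvalues of the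
other levels differ from that of v0. *)
Lemma hw_decomposition v :
  exists c : F, exists2 w, off_weight w & v = c%:A *: v0 + w.
Proof.
have lev0 w : level 0 w -> exists c : F, w = c%:A *: v0.
  have : forall n w, level n w -> n = 0%N -> exists c : F, w = c%:A *: v0.
    move=> n z; elim=> {n z} [|n|n v1 w1 _ IHv _ IHw|n c v1 _ IH|//].
    - by exists 1; rewrite !scale1r.
    - by exists 0; rewrite !scale0r.
    - move=> n0; have [c ->] := IHv n0; have [d ->] := IHw n0.
      by exists (c + d); rewrite fscaleDl.
    - by move=> n0; have [d ->] := IH n0; exists (c * d); rewrite fscaleA.
  by move=> h lw; exact: h lw _.
have [s ls ->] := level_decomposition v; elim: s ls => [|z s IH] ls.
  by exists 0, 0; [exact: off_weight0 | rewrite big_nil !scale0r add0r].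
have [w ws|c [w ow sE]] := IH; first by apply: ls; rewrite inE ws orbT.
rewrite big_cons sE; have [[|n] lz] := ls z (mem_head _ _).
  have [d ->] := lev0 _ lz; exists (d + c), w => //.
  by rewrite addrA fscaleDl.
exists c, (z + w); last by rewrite addrCA.
apply: off_weightD => //; apply: off_weight_eigen (level_grading lz).
by rewrite -subr_eq0 addrAC subrr sub0r oppr_eq0 pnatr_eq0.
Qed.

Hypothesis v0_neq0 : v0 != 0.

(** The largest submodule inside [off_weight], which is only a subspace. *)
Definition radical : {pred V} := fun v => `[< forall x : U, off_weight (x *: v) >].

Lemma radical_closed : submod_closed radical.
Proof.
split=> [|a v w /asboolP rv /asboolP rw]; apply/asboolP => x.
  by rewrite scaler0; exact: off_weight0.
by rewrite scalerDr scalerA; exact: off_weightD.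
Qed.

Lemma hw_notin_radical : v0 \notin radical.
Proof.
by apply/negP => /asboolP/(_ 1); rewrite scale1r; exact: hw_off_weight.
Qed.

Lemma generator_full (N : {pred V}) : submod_closed N -> v0 \in N -> forall v, v \in N.
Proof. by move=> Nc h v; move: (gen v) => /asboolP; apply=> // _ ->. Qed.

(** If x v = c v0 + w with w off the weight, a polynomial in the grading kills
w and multiplies v0 by a nonzero scalar; so c != 0 would put v0 into the
submodule. *)
Lemma proper_sub_radical (N : {pred V}) :
  submod_closed N -> v0 \notin N -> {subset N <= radical}.
Proof.
move=> [N0 Nl] v0N v vN; apply/asboolP => x.
have NZ y w : w \in N -> y *: w \in N.
  by move=> wN; rewrite -[_ *: w]addr0; exact: Nl.
have [c [w [p p0 pw] e]] := hw_decomposition (x *: v).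
have : horner_alg grading p *: (x *: v) \in N by apply/NZ/NZ.
rewrite e scalerDr pw addr0 fscale_comm (horner_eigen _ grading_hw) fscaleA.
have [->|c0] := eqVneq c 0; first by rewrite !scale0r add0r; exists p.
move=> h; case/negP: v0N; have := NZ ((c * p.[lam])^-1)%:A _ h.
by rewrite fscaleA mulVf ?mulf_neq0 // !scale1r.
Qed.

Lemma radical_maximal : the_maximal_submod radical.
Proof.
split; first split.
- exact: radical_closed.
- by exists v0; exact: hw_notin_radical.
- move=> N Nc sub; case: (boolP (v0 \in N)) => [/generator_full h|v0N].
    by right; exact: h.
  left=> v; apply/idP/idP; last exact: sub.
  exact: proper_sub_radical.
move=> N [Nc [v vN] Nmax].
have v0N : v0 \notin N by apply: contra vN => h; exact: generator_full.
have [h|h] := Nmax _ radical_closed (proper_sub_radical Nc v0N).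
  by move=> w; rewrite h.
by have := hw_notin_radical; rewrite h.
Qed.

Lemma rad_submodE : rad_submod V =i radical.
Proof.
move=> v; apply/asboolP/idP => [|rv N [Nm uN]]; first by apply; exact: radical_maximal.
by rewrite -(uN _ (proj1 radical_maximal)).
Qed.

End Vector.
End HighestWeight.

(** * Verma modules and their simple quotients *)

Section SimpleHighestWeight.
Variables (m : nat) (F : numFieldType) (Q : 'I_m.-1 -> F).
Local Notation U := (Ugl Q).

Lemma quot_proj0P (A : pzRingType) (V : lmodType A) (N : submodClosed V) v :
  quot_proj N v = 0 <-> v \in (N : {pred V}).
Proof.
have e0 : quot_proj N 0 = 0 by rewrite /quot_proj [LHS]raddf0.
by rewrite -e0 quot_projP subr0.
Qed.

Lemma exists_linear (V W : lmodType U) (v : V) (w : W) :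
  (forall v', exists x : U, v' = x *: v) ->
  (forall x : U, x *: v = 0 -> x *: w = 0) ->
  exists f : {linear V -> W}, forall x : U, f (x *: v) = x *: w.
Proof.
move=> gen ann; pose f v' : W := projT1 (cid (gen v')) *: w.
have fE x : f (x *: v) = x *: w.
  rewrite /f; case: (cid _) => y /= e; apply/eqP.
  by rewrite -subr_eq0 -scalerBl ann // scalerBl e subrr.
have lf : linear f.
  move=> a v1 v2; have [x ->] := gen v1; have [y ->] := gen v2.
  by rewrite scalerA -scalerDl !fE scalerDl scalerA.
pose fL := GRing.isLinear.Build U V W *:%R f lf.
by exists (HB.pack_for {linear V -> W} f fL).
Qed.

Lemma inj_surj_bijective (V W : Type) (f : V -> W) :
  injective f -> (forall w, exists v, f v = w) -> bijective f.
Proof.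
move=> fi fs; pose g w := projT1 (cid (fs w)).
have fgK : cancel g f by move=> w; rewrite /g; case: (cid _).
by exists g => // v; apply: fi; rewrite fgK.
Qed.

Lemma linear_ker_inj (V W : lmodType U) (f : {linear V -> W}) :
  (forall v, f v = 0 -> v = 0) -> injective f.
Proof.
move=> h v w e; apply/eqP; rewrite -subr_eq0; apply/eqP/h.
by rewrite linearB /= e subrr.
Qed.

Lemma simple_generates (V : lmodType U) (v : V) :
  simple_module V -> v != 0 -> forall w, w \in span_submod [set v]%classic.
Proof.
move=> [_ h] v0; have [h0|//] := h _ (span_submod_closed [set v]%classic).
by case/eqP: v0; apply: h0; apply/asboolP => N _; exact.
Qed.

Variable u : 'I_m -> nat -> F.
Local Notation M := (verma Q u).

Definition verma_vector : M := quot_proj (span_submod (verma_rels u)) (1 : U^o).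

Lemma verma_vectorE (x : U) :
  x *: verma_vector = quot_proj (span_submod (verma_rels u)) (x : U^o).
Proof. by rewrite /verma_vector [LHS]quot_scaleE [_ *: _]mulr1. Qed.

Lemma verma_generates (v : M) : exists x : U, v = x *: verma_vector.
Proof. by elim/quot_projW: v => x; exists x; rewrite verma_vectorE. Qed.

Lemma verma_span (v : M) : v \in span_submod [set verma_vector]%classic.
Proof.
have [x ->] := verma_generates v; apply: rpredZ.
by apply/asboolP => N _; exact.
Qed.

Lemma verma_hw : hw_vector u verma_vector.
Proof.
split=> [i t|j t].
  rewrite verma_vectorE; apply/quot_proj0P/asboolP => N _; apply.
  by left; exists i, t.
rewrite !verma_vectorE; apply/quot_projP/asboolP => N _; apply.
by right; exists j, t.
Qed.

(** A proper left ideal J containing the relations, in practice the annihilator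
of a highest weight vector of some concrete module, shows that the Verma module
is nonzero, and the image of J then lies in the radical. *)
Section LeftIdeal.
Variable J : {pred U^o}.
Hypothesis J_closed : submod_closed J.
Hypothesis rels_J : forall x, verma_rels u x -> x \in J.
Hypothesis J_proper : (1 : U^o) \notin J.

Lemma span_rels_sub x : x \in span_submod (verma_rels u) -> x \in J.
Proof. by move=> /asboolP; apply. Qed.

Lemma verma_vector_neq0 : verma_vector != 0.
Proof.
apply/eqP => /quot_proj0P /span_rels_sub h.
by case/negP: J_proper.
Qed.

Lemma left_ideal_rad (x : U) :
  x \in (J : {pred U^o}) -> x *: verma_vector \in rad_submod M.
Proof.
move=> xJ; rewrite (rad_submodE verma_hw verma_span verma_vector_neq0).
pose N : {pred M} := fun v => `[< exists2 y : U, y \in (J : {pred U^o}) & v = y *: verma_vector >].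
apply: (proper_sub_radical verma_hw verma_span (N := N)); last by apply/asboolP; exists x.
  case: J_closed => J0 Jl; split; first by apply/asboolP; exists 0; rewrite ?scale0r.
  move=> a v w /asboolP[y yJ ->] /asboolP[z zJ ->]; apply/asboolP.
  by exists (a * y + z); [exact: Jl | rewrite scalerDl scalerA].
apply/negP => /asboolP[y yJ]; rewrite -[X in X = _]scale1r !verma_vectorE.
move=> /quot_projP /span_rels_sub h; case/negP: J_proper.
have [_ Jl] := J_closed; have := Jl 1 _ _ h yJ.
by rewrite [1 *: _]mul1r subrK.
Qed.
End LeftIdeal.

Section Nonzero.
Hypothesis verma_neq0 : verma_vector != 0.
Local Notation L := (simple_hw Q u).

Definition simple_hw_vector : L := quot_proj (rad_submod M) verma_vector.

Lemma simple_hw_vectorE (x : U) :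
  x *: simple_hw_vector = quot_proj (rad_submod M) (x *: verma_vector).
Proof. by rewrite /simple_hw_vector [LHS]quot_scaleE. Qed.

Lemma simple_hw_generates (v : L) : exists x : U, v = x *: simple_hw_vector.
Proof.
elim/quot_projW: v => v; have [x ->] := verma_generates v.
by exists x; rewrite simple_hw_vectorE.
Qed.

Lemma simple_hw_vector_neq0 : simple_hw_vector != 0.
Proof.
apply/eqP => /quot_proj0P; rewrite (rad_submodE verma_hw verma_span verma_neq0).
by rewrite (negbTE (hw_notin_radical verma_hw verma_neq0)).
Qed.

Lemma simple_hw_hw : hw_vector u simple_hw_vector.
Proof.
case: verma_hw => hX hI; split=> [i t|j t].
  by rewrite simple_hw_vectorE hX; apply/quot_proj0P; exact: rpred0.
by rewrite !simple_hw_vectorE hI.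
Qed.

(** Submodules of the quotient pull back to submodules containing the radical.
*)
Lemma simple_hw_simple : simple_module L.
Proof.
split; first by exists simple_hw_vector; exact: simple_hw_vector_neq0.
move=> N [N0 Nl].
have [[_ _ +] _] := radical_maximal verma_hw verma_span verma_neq0.
pose N' : {pred M} := fun v => quot_proj (rad_submod M) v \in N.
move=> /(_ N'); case.
- split; first by rewrite unfold_in /N' (quot_proj0P _ _).2 //; exact: rpred0.
  move=> a v w; rewrite !unfold_in /N' => vN wN.
  by rewrite quot_projD -quot_scaleE; exact: Nl.
- move=> v; rewrite -(rad_submodE verma_hw verma_span verma_neq0) => vR.
  by rewrite unfold_in /N' ((quot_proj0P _ _).2 vR).
- move=> h; left=> v; elim/quot_projW: v => v vN; apply/quot_proj0P.
  rewrite (rad_submodE verma_hw verma_span verma_neq0).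
  have : v \in N' by rewrite unfold_in.
  by rewrite (h v).
- by move=> h; right=> v; elim/quot_projW: v => v; have := h v; rewrite unfold_in.
Qed.

Lemma simple_hw_highest : highest_weight_module u L.
Proof.
exists simple_hw_vector; split; [exact: simple_hw_vector_neq0| |exact: simple_hw_hw.1|exact: simple_hw_hw.2].
exact: (simple_generates simple_hw_simple simple_hw_vector_neq0).
Qed.

End Nonzero.

(** The annihilator of v is a left ideal as above, hence maps into the radical
of the Verma module. So x v |-> x v_L is well defined from V to L(u), and its
kernel is zero because V is simple. *)
Lemma hw_simple_iso (V : lmodType U) (v : V) :
  simple_module V -> v != 0 -> hw_vector u v ->
  isomorphic_modules V (simple_hw Q u).
Proof.
move=> Vs v0 [hX hI]; have Vg := simple_generates Vs v0.
pose J : {pred U^o} := fun x => (x : U) *: v == 0.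
have Jc : submod_closed J.
  split=> [|a x y]; first by rewrite unfold_in scale0r.
  rewrite !unfold_in => /eqP xv /eqP yv.
  by rewrite scalerDl [a *: x](erefl (a * x)) -scalerA xv yv scaler0 addr0.
have JR x : verma_rels u x -> x \in J.
  case=> [[i [t ->]]|[j [t ->]]]; rewrite unfold_in ?hX //.
  by rewrite scalerBl hI subrr.
have J1 : (1 : U^o) \notin J by rewrite unfold_in scale1r.
have Mn0 := verma_vector_neq0 Jc JR J1.
have gen v' : exists x : U, v' = x *: v by exact: hw_generates Vg v'.
have [f fE] : exists f : {linear V -> simple_hw Q u},
    forall x : U, f (x *: v) = x *: simple_hw_vector.
  apply: exists_linear => // x xv; rewrite simple_hw_vectorE; apply/quot_proj0P.
  by apply: left_ideal_rad Jc JR J1 _ _; rewrite unfold_in xv.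
exists f; apply: inj_surj_bijective => [|w]; last first.
  by have [x ->] := simple_hw_generates w; exists (x *: v).
apply: linear_ker_inj; pose K : {pred V} := fun v' => f v' == 0.
have Kc : submod_closed K.
  split=> [|a x y]; first by rewrite unfold_in raddf0.
  by rewrite !unfold_in linearP => /eqP -> /eqP ->; rewrite scaler0 addr0.
case: (Vs.2 K Kc) => [h w fw|/(_ v)].
  by apply: h; rewrite unfold_in /K fw.
rewrite unfold_in /K -[v]scale1r fE scale1r => /eqP e.
by have := simple_hw_vector_neq0 Mn0; rewrite e eqxx.
Qed.

End SimpleHighestWeight.

(** * Uniqueness of the highest weight and of the parameters *)

Section WeightInvariance.
Variables (m : nat) (F : numFieldType) (Q : 'I_m.-1 -> F).
Local Notation U := (Ugl Q).

Lemma grading_eigenvalue (V : lmodType U) u (v0 w : V) c :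
  hw_vector u v0 -> (forall v, v \in span_submod [set v0]%classic) ->
  w != 0 -> grading Q *: w = c%:A *: w ->
  exists n, c = grading_weight u - n%:R.
Proof.
move=> hw gen w0 wc; have [s ls sE] := level_decomposition hw gen w.
have : exists2 p : {poly F}, horner_alg (grading Q) p *: (\sum_(z <- s) z) = 0 &
    forall x, root p x -> exists n, x = grading_weight u - n%:R.
  elim: s ls {sE} => [|z s IH] ls.
    by exists 1; [rewrite big_nil scaler0 | move=> x; rewrite rootC oner_eq0].
  have [y ys|p pz pr] := IH; first by apply: ls; rewrite inE ys orbT.
  have [n lz] := ls z (mem_head _ _).
  exists (p * ('X - (grading_weight u - n%:R)%:P)); last first.
    by move=> x; rewrite rootM root_XsubC => /orP[/pr //|/eqP ->]; exists n.
  rewrite big_cons scalerDr rmorphM /= -scalerA.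
  rewrite (horner_eigen _ (level_grading hw lz)) hornerXsubC subrr !scale0r.
  by rewrite scaler0 add0r -rmorphM mulrC rmorphM -scalerA pz scaler0.
rewrite -sE => -[p]; rewrite (horner_eigen _ wc) => e; apply.
apply: contraNT w0; rewrite rootE => pc.
by rewrite -[w]scale1r -[1](scale1r 1) -(mulVf pc) -fscaleA e scaler0.
Qed.

Lemma hw_weight_unique (V : lmodType U) u u' (v0 w : V) :
  hw_vector u v0 -> v0 != 0 -> (forall v, v \in span_submod [set v0]%classic) ->
  hw_vector u' w -> w != 0 -> grading_weight u' = grading_weight u ->
  forall j t, u j t = u' j t.
Proof.
move=> hw v00 gen hw' w0 uu' j t.
(* As u and u' give the same eigenvalue, the component of w off the weight is zero. *)
have [c [z oz wE]] := hw_decomposition hw gen w.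
have z0 : z = 0.
  apply: off_weight_on oz; have := grading_hw hw'.
  rewrite uu' wE !scalerDr fscale_comm (grading_hw hw) !fscaleA mulrC.
  by move/addrI.
move: hw'.2 w0 => /(_ j t); rewrite wE z0 addr0 fscale_comm hw.2 !fscaleA => e w0.
have c0 : c != 0 by apply: contraNneq w0 => ->; rewrite !scale0r.
have : ((u j t - u' j t) * c)%:A *: v0 = 0.
  by rewrite mulrBl fscaleBl -e mulrC subrr.
set d := _ * c => ed; apply/eqP; rewrite -subr_eq0.
have : d == 0.
  apply: contraNT v00 => d0.
  by rewrite -[v0]scale1r -[1](scale1r 1) -(mulVf d0) -fscaleA ed scaler0.
by rewrite mulf_eq0 (negbTE c0) orbF.
Qed.

(** By [grading_eigenvalue] the eigenvalues attached to v and w each lie below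
the other by a natural number, so they coincide, and then f v lies on the line
of w. *)
Lemma hw_iso_weight (V W : lmodType U) u u' (v : V) (w : W) :
  hw_vector u v -> v != 0 -> (forall x, x \in span_submod [set v]%classic) ->
  hw_vector u' w -> w != 0 -> (forall x, x \in span_submod [set w]%classic) ->
  isomorphic_modules V W -> forall j t, u j t = u' j t.
Proof.
move=> hw v0 gen hw' w0 gen' [f [g gK fK]] j t.
have fZ (x : U) z : f (x *: z) = x *: f z by exact: linearZ_LR.
have f0 : f 0 = 0 by exact: raddf0.
have gZ (x : U) z : g (x *: z) = x *: g z by rewrite -[RHS]gK fZ fK.
have fv0 : f v != 0 by apply: contraNneq v0 => e; rewrite -(gK v) e -f0 gK.
have gw0 : g w != 0 by apply: contraNneq w0 => e; rewrite -(fK w) e f0.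
have hwf : hw_vector u (f v).
  by split=> [i r|k r]; rewrite -fZ (hw.1, hw.2) ?f0 ?fZ.
have [a la] := grading_eigenvalue hw' gen' fv0 (grading_hw hwf).
have gE : grading Q *: g w = (grading_weight u')%:A *: g w.
  by rewrite -!gZ (grading_hw hw').
have [b lb] := grading_eigenvalue hw gen gw0 gE.
apply/esym/(hw_weight_unique hw' w0 gen' hwf fv0).
move: la; rewrite lb -addrA -opprD -natrD => /eqP.
rewrite -subr_eq0 opprB addrC addrNK pnatr_eq0 addn_eq0 => /andP[/eqP b0 _].
by rewrite b0 subr0.
Qed.

Lemma simple_hw_iso_weight u u' :
  verma_vector Q u != 0 -> verma_vector Q u' != 0 ->
  isomorphic_modules (simple_hw Q u) (simple_hw Q u') ->
  forall j t, u j t = u' j t.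
Proof.
move=> n0 n0'; apply: hw_iso_weight (simple_hw_hw Q u) (simple_hw_vector_neq0 n0)
  _ (simple_hw_hw Q u') (simple_hw_vector_neq0 n0') _.
  exact: simple_generates (simple_hw_simple n0) (simple_hw_vector_neq0 n0).
exact: simple_generates (simple_hw_simple n0') (simple_hw_vector_neq0 n0').
Qed.

End WeightInvariance.

Section PowerSums.
Variable F : numFieldType.

Lemma sum_vanish (f : F -> F) x (s : seq F) :
  (forall y, y \in s -> y != x -> f y = 0) ->
  \sum_(y <- s) f y = (count_mem x s)%:R * f x.
Proof.
elim: s => [|y s IH] h; first by rewrite big_nil mul0r.
rewrite big_cons IH /= => [|z zs]; last by apply: h; rewrite inE zs orbT.
rewrite natrD mulrDl; case: eqP => [->|/eqP yx]; first by rewrite mul1r.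
by rewrite mul0r h ?mem_head.
Qed.

(** Summed over a sequence with entries in r, this polynomial reads off the
multiplicity of x. *)
Lemma interpolation (r : seq F) x :
  exists2 f : {poly F}, f.[x] != 0 & forall y, y \in r -> y != x -> f.[y] = 0.
Proof.
exists (\prod_(y <- r | y != x) ('X - y%:P)) => [|y yr yx].
  rewrite horner_prod prodf_seq_neq0; apply/allP => y _; apply/implyP => yx.
  by rewrite hornerXsubC subr_eq0 eq_sym.
rewrite -big_filter; apply/eqP; rewrite [_ == 0]root_prod_XsubC.
by rewrite mem_filter yx.
Qed.

Lemma power_sums_horner (s s' : seq F) c a b :
  (forall t, \sum_(g <- s) g ^+ t + c ^+ t * a =
             \sum_(g <- s') g ^+ t + c ^+ t * b) ->
  forall f : {poly F}, \sum_(g <- s) f.[g] + f.[c] * a =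
                       \sum_(g <- s') f.[g] + f.[c] * b.
Proof.
move=> h f.
have hE (r : seq F) d : \sum_(g <- r) f.[g] + f.[c] * d =
    \sum_(i < size f) f`_i * (\sum_(g <- r) g ^+ i + c ^+ i * d).
  under [RHS]eq_bigr do rewrite mulrDr mulrA.
  rewrite big_split /= -mulr_suml -horner_coef; congr (_ + _).
  under eq_bigr do rewrite horner_coef.
  by rewrite exchange_big; apply: eq_bigr => i _; rewrite mulr_sumr.
by rewrite !hE; apply: eq_bigr => i _; rewrite h.
Qed.

(** The point c carries an arbitrary scalar rather than a multiplicity, so it
must be kept apart from the other points unless the two scalars agree. *)
Lemma power_sums_inj (s s' : seq F) c a b :
  (forall t, \sum_(g <- s) g ^+ t + c ^+ t * a =
             \sum_(g <- s') g ^+ t + c ^+ t * b) ->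
  a = b \/ (c \notin s) && (c \notin s') ->
  perm_eq s s' /\ a = b.
Proof.
move=> h ab.
have cnt x : a = b \/ x != c -> count_mem x s = count_mem x s'.
  have [f fx fy] := interpolation (c :: s ++ s') x.
  have fs r : {subset r <= s ++ s'} ->
      \sum_(g <- r) f.[g] = (count_mem x r)%:R * f.[x].
    by move=> rs; apply: sum_vanish => y /rs yr; apply: fy; rewrite inE yr orbT.
  move=> abx; have := power_sums_horner h f.
  rewrite !fs => [|y|y]; try by rewrite mem_cat => ->; rewrite ?orbT.
  suff -> : f.[c] * a = f.[c] * b by move/addIr/(mulIf fx)/eqP; rewrite eqr_nat => /eqP.
  case: abx => [-> //|xc]; rewrite fy ?mem_head ?mul0r //.
  by rewrite eq_sym.
have p : perm_eq s s'.
  apply/allP => x xs; apply/eqP; apply: cnt; case: ab => [|/andP[cs cs']]; [by left|right].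
  by apply: contraTneq xs => ->; rewrite mem_cat negb_or cs.
split=> //; have := h 0%N; rewrite (perm_big _ p) /= => /addrI.
by rewrite !expr0 !mul1r.
Qed.

End PowerSums.

Section ParametersFromWeights.
Variables (F : numClosedFieldType) (m : nat) (Q : 'I_m.-1 -> F).

Lemma monic_roots (p : {poly F}) :
  p \is monic -> p = \prod_(g <- roots_of p) ('X - g%:P).
Proof.
move=> /monicP p1; rewrite /roots_of; case: (closed_field_poly_normal p) => r /= {1}->.
by rewrite p1 scale1r.
Qed.

Lemma size_roots_of (p : {poly F}) : p \is monic -> size (roots_of p) = (size p).-1.
Proof. by move=> /monic_roots {2}->; rewrite size_prod_XsubC. Qed.

Lemma roots_ofE (p : {poly F}) x : p \is monic -> (x \in roots_of p) = root p x.
Proof. by move=> /monic_roots {2}->; rewrite root_prod_XsubC. Qed.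

(** One formula covers all cases: if Q_i = 0 then beta_i = 0, and at t = 0 the
power sum counts the roots. *)
Lemma u_weightE (pb : 'I_m.-1 -> {poly F} * F) i t :
  monic_set (Q i) (pb i).1 -> Bset (Q i) (pb i).2 ->
  u_weight Q pb i t =
  \sum_(g <- roots_of (pb i).1) g ^+ t + (Q i)^-1 ^+ t * (pb i).2.
Proof.
rewrite /u_weight; case: (pb i) => phi beta /= [mon _]; rewrite /Bset.
case: (t =P 0%N) => [-> _|_].
  under eq_bigr do rewrite expr0.
  by rewrite expr0 mul1r -size_roots_of // big_const_seq count_predT iter_addr_0.
rewrite exprVn; case: (eqVneq (Q i) 0) => // _ /= ->.
by rewrite mulr0 addr0.
Qed.

Lemma ut_weight_last (j : 'I_m) (p : parameters F m) t :
  (m.-1 <= j)%N -> ut_weight Q p j t = p.2 t.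
Proof.
move=> mj; rewrite /ut_weight big1 ?add0r // => k jk.
by have := leq_trans mj jk; rewrite leqNgt ltn_ord.
Qed.

Lemma ut_weight_diff (p : parameters F m) i t :
  ut_weight Q p (ord_this i) t - ut_weight Q p (ord_next i) t = u_weight Q p.1 i t.
Proof.
rewrite /ut_weight [X in X - _]addrC [X in _ - X]addrC opprD addrACA subrr add0r.
rewrite (bigD1 i) //=; rewrite [X in _ + X - _](_ : _ = \sum_(k < m.-1 | (i < k)%N) u_weight Q p.1 k t) ?addrK //.
by apply: eq_bigl => k; rewrite ltn_neqAle andbC eq_sym.
Qed.

(** Consecutive differences of the weight isolate the contribution of each i,
and its last row is h. *)
Lemma ut_weight_inj (hm : (0 < m)%N) (p p' : parameters F m) :
  parameter_set Q p -> parameter_set Q p' ->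
  (forall j t, ut_weight Q p j t = ut_weight Q p' j t) -> p = p'.
Proof.
move=> pQ pQ' e.
have e2 : p.2 = p'.2.
  have lt : (m.-1 < m)%N by rewrite prednK.
  by apply/funext => t; rewrite -2?(@ut_weight_last (Ordinal lt)) ?e.
have e1 : p.1 = p'.1.
  apply/funext => i; have [[m1 r1] b1] := pQ i; have [[m2 r2] b2] := pQ' i.
  have [] := @power_sums_inj F (roots_of (p.1 i).1) (roots_of (p'.1 i).1)
    (Q i)^-1 (p.1 i).2 (p'.1 i).2.
  - move=> t; rewrite -!u_weightE //.
    by rewrite -!ut_weight_diff !e.
  - move: b1 b2; rewrite /Bset; have [Q0|Q0] /= := eqVneq (Q i) 0.
      by move=> -> ->; left.
    by right; rewrite !roots_ofE // r1 // r2.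
  move=> pe be; rewrite [LHS]surjective_pairing [RHS]surjective_pairing be.
  by rewrite (monic_roots m1) (perm_big _ pe) /= -monic_roots.
by rewrite [LHS]surjective_pairing e1 e2 -surjective_pairing.
Qed.

End ParametersFromWeights.

(** * Matrix representations and their tensor products *)

Lemma jacobi_cancel (M : zmodType) (p q r s t u : M) :
  p - q - (r - s) + (r - t - (u - q)) + (u - s - (p - t)) = 0.
Proof.
rewrite !opprB !addrA.
rewrite [LHS](ACl (1*12*(2*7)*(4*5)*(3*10)*(6*11)*(8*9))).
by rewrite /= !(subrr, addNr, addr0).
Qed.

Lemma tensor_cancel (M : zmodType) (p p' q r s s' : M) :
  p + q + (r + s) - (p' + r + (q + s')) = p - p' + (s - s').
Proof.
rewrite !opprD !addrA.
rewrite [LHS](ACl (1*5*4*8*(2*7)*(3*6))).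
by rewrite /= !(subrr, addr0).
Qed.

Section MatrixRepresentations.
Variables (m : nat) (F : fieldType) (Q : 'I_m.-1 -> F).
Local Notation U := (Ugl Q).
Local Notation term := (lie_term F (gl_gen m)).

Section Eval.
Variables (N : nat) (a : gl_gen m -> 'M[F]_N).

Fixpoint lie_eval (t : term) : 'M[F]_N :=
  match t with
  | LGen g => a g
  | LZero => 0
  | LAdd x y => lie_eval x + lie_eval y
  | LOpp x => - lie_eval x
  | LScale c x => c *: lie_eval x
  | LBr x y => lie_eval x *m lie_eval y - lie_eval y *m lie_eval x
  end.

(** The generators may be sent to any matrices whose brackets respect the
defining relations; the universal properties of the presented Lie algebra and
of its enveloping algebra then provide [rep_eval]. *)
Definition matrix_rep := forall x y, gl_rel Q x y -> lie_eval x = lie_eval y.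

Hypothesis rep : matrix_rep.

Lemma lie_eval_cong x y : lie_cong (gl_rel Q) x y -> lie_eval x = lie_eval y.
Proof.
elim=> {x y} /=.
- by move=> x y; exact: rep.
- by [].
- by move=> x y _ ->.
- by move=> x y z _ -> _ ->.
- by move=> x x' y y' _ -> _ ->.
- by move=> x x' _ ->.
- by move=> c x x' _ ->.
- by move=> x x' y y' _ -> _ ->.
- by move=> x y z; rewrite addrA.
- by move=> x y; rewrite addrC.
- by move=> x; rewrite add0r.
- by move=> x; rewrite addNr.
- by move=> c d x; rewrite scalerA.
- by move=> x; rewrite scale1r.
- by move=> c x y; rewrite scalerDr.
- by move=> c d x; rewrite scalerDl.
- by move=> x y z; rewrite mulmxDl mulmxDr opprD addrACA.
- by move=> x y z; rewrite mulmxDl mulmxDr opprD addrACA.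
- by move=> c x y; rewrite -scalemxAl -scalemxAr scalerBr.
- by move=> c x y; rewrite -scalemxAl -scalemxAr scalerBr.
- by move=> x; rewrite subrr.
- move=> x y z; rewrite !mulmxBl !mulmxBr !mulmxA.
  exact: jacobi_cancel.
Qed.

Fixpoint env_eval (t : env_term F (gl_lie Q)) : 'M[F]_N :=
  match t with
  | EGen g => lie_eval (repr g)
  | EZero => 0
  | EOne => 1%:M
  | EAdd x y => env_eval x + env_eval y
  | EOpp x => - env_eval x
  | EScale c x => c *: env_eval x
  | EMul x y => env_eval x *m env_eval y
  end.

Lemma lie_eval_repr (t : term) : lie_eval (repr (\pi_(gl_lie Q) t)) = lie_eval t.
Proof. by apply: lie_eval_cong; exact: lie_reprK. Qed.

Lemma env_eval_cong x y : env_cong x y -> env_eval x = env_eval y.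
Proof.
elim=> {x y} /=.
- elim/quotW=> x; elim/quotW=> y.
  by rewrite [X in repr X]pl_piD !lie_eval_repr.
- by move=> c; elim/quotW=> x; rewrite [X in repr X]pl_piZ !lie_eval_repr.
- elim/quotW=> x; elim/quotW=> y.
  by rewrite [X in repr X]pl_brE !lie_eval_repr.
- by [].
- by move=> x y _ ->.
- by move=> x y z _ -> _ ->.
- by move=> x x' y y' _ -> _ ->.
- by move=> x x' _ ->.
- by move=> c x x' _ ->.
- by move=> x x' y y' _ -> _ ->.
- by move=> x y z; rewrite addrA.
- by move=> x y; rewrite addrC.
- by move=> x; rewrite add0r.
- by move=> x; rewrite addNr.
- by move=> x y z; rewrite mulmxA.
- by move=> x; rewrite mul1mx.
- by move=> x; rewrite mulmx1.
- by move=> x y z; rewrite mulmxDl.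
- by move=> x y z; rewrite mulmxDr.
- by move=> c d x; rewrite scalerA.
- by move=> x; rewrite scale1r.
- by move=> c x y; rewrite scalerDr.
- by move=> c d x; rewrite scalerDl.
- by move=> c x y; rewrite scalemxAl.
- by move=> c x y; rewrite scalemxAr.
Qed.

Definition rep_eval (x : U) : 'M[F]_N := env_eval (repr x).

Lemma rep_eval_pi t : rep_eval (\pi_(enveloping (gl_lie Q)) t) = env_eval t.
Proof. by apply: env_eval_cong; exact: env_reprK. Qed.

Lemma rep_evalD x y : rep_eval (x + y) = rep_eval x + rep_eval y.
Proof.
elim/quotW: x => x; elim/quotW: y => y.
by rewrite [X in rep_eval X]env_piD !rep_eval_pi.
Qed.

Lemma rep_evalM x y : rep_eval (x * y) = rep_eval x *m rep_eval y.
Proof.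
elim/quotW: x => x; elim/quotW: y => y.
by rewrite [X in rep_eval X]env_piM !rep_eval_pi.
Qed.

Lemma rep_evalZ c x : rep_eval (c *: x) = c *: rep_eval x.
Proof. by elim/quotW: x => x; rewrite [X in rep_eval X]env_piZ !rep_eval_pi. Qed.

Lemma rep_eval1 : rep_eval 1 = 1%:M.
Proof. by rewrite -[1]/(env_one _) env_oneE rep_eval_pi. Qed.

Lemma rep_eval0 : rep_eval 0 = 0.
Proof. by rewrite -(scale0r (1 : U)) rep_evalZ scale0r. Qed.

Lemma rep_evalX b i t : rep_eval (UX Q b i t) = a (GX b i t).
Proof. by rewrite rep_eval_pi /= lie_eval_repr. Qed.

Lemma rep_evalI j t : rep_eval (UI Q j t) = a (GI j t).
Proof. by rewrite rep_eval_pi /= lie_eval_repr. Qed.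

End Eval.

Definition tensor_rep N N' (a : gl_gen m -> 'M[F]_N) (b : gl_gen m -> 'M[F]_N') g :
    'M[F]_(N * N') := a g *t 1%:M + 1%:M *t b g.

Lemma tensmxDl k l p q (A B : 'M[F]_(k, l)) (C : 'M[F]_(p, q)) :
  (A + B) *t C = A *t C + B *t C.
Proof. by apply/matrixP => i j; rewrite !mxE mulrDl. Qed.
Lemma tensmxDr k l p q (C : 'M[F]_(k, l)) (A B : 'M[F]_(p, q)) :
  C *t (A + B) = C *t A + C *t B.
Proof. by apply/matrixP => i j; rewrite !mxE mulrDr. Qed.
Lemma tensmxZl k l p q c (A : 'M[F]_(k, l)) (C : 'M[F]_(p, q)) :
  (c *: A) *t C = c *: (A *t C).
Proof. by apply/matrixP => i j; rewrite !mxE mulrA. Qed.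
Lemma tensmxZr k l p q c (A : 'M[F]_(k, l)) (C : 'M[F]_(p, q)) :
  A *t (c *: C) = c *: (A *t C).
Proof. by apply/matrixP => i j; rewrite !mxE mulrCA. Qed.
Lemma tensmxNl k l p q (A : 'M[F]_(k, l)) (C : 'M[F]_(p, q)) :
  (- A) *t C = - (A *t C).
Proof. by rewrite -!scaleN1r tensmxZl. Qed.
Lemma tensmxNr k l p q (A : 'M[F]_(k, l)) (C : 'M[F]_(p, q)) :
  A *t (- C) = - (A *t C).
Proof. by rewrite -!scaleN1r tensmxZr. Qed.

Lemma tensmx_mul_col k l p q (A : 'M[F]_(k, l)) (B : 'M[F]_(p, q))
    (w : 'cV_l) (w' : 'cV_q) :
  (A *t B) *m (w *t w' : 'cV_(l * q)) = (A *m w) *t (B *m w') :> 'cV_(k * p).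
Proof. exact: (@tensmx_mul F k l p q 1 1 A B w w'). Qed.

(** The formula for generators propagates to all Lie expressions, because in a
bracket the mixed terms cancel; relations are therefore inherited without being
checked one by one. *)
Lemma lie_eval_tensor N N' (a : gl_gen m -> 'M[F]_N) (b : gl_gen m -> 'M[F]_N') t :
  lie_eval (tensor_rep a b) t = lie_eval a t *t 1%:M + 1%:M *t lie_eval b t.
Proof.
elim: t => [g||x IHx y IHy|x IH|c x IH|x IHx y IHy] /=.
- by [].
- by rewrite tens0mx tensmx0 addr0.
- by rewrite IHx IHy tensmxDl tensmxDr addrACA.
- by rewrite IH tensmxNl tensmxNr opprD.
- by rewrite IH tensmxZl tensmxZr scalerDr.
rewrite IHx IHy !mulmxDl !mulmxDr !tensmx_mul !mul1mx !mulmx1.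
rewrite tensmxDl tensmxDr tensmxNl tensmxNr.
by rewrite tensor_cancel.
Qed.

End MatrixRepresentations.

Section Realizable.
Variables (m : nat) (F : numFieldType) (Q : 'I_m.-1 -> F).
Local Notation U := (Ugl Q).

(** Finite dimensional modules are given by matrices acting on column vectors,
so that the tensor product is the Kronecker product. *)
Definition realizable (u : 'I_m -> nat -> F) :=
  exists (N : nat) (a : gl_gen m -> 'M[F]_N) (w : 'cV[F]_N),
  [/\ matrix_rep Q a, w != 0, forall i t, a (GX true i t) *m w = 0 &
      forall j t, a (GI j t) *m w = u j t *: w].

Lemma realizable_ext u u' : (forall j t, u j t = u' j t) -> realizable u -> realizable u'.
Proof.
by move=> e [N [a [w [ra w0 aX aI]]]]; exists N, a, w; split=> // j t; rewrite aI e.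
Qed.

Lemma realizableD u u' : realizable u -> realizable u' ->
  realizable (fun j t => u j t + u' j t).
Proof.
move=> [N [a [w [ra w0 aX aI]]]] [N' [a' [w' [ra' w0' aX' aI']]]].
exists (N * N')%N, (tensor_rep a a'), (w *t w'); split.
- by move=> x y xy; rewrite !lie_eval_tensor (ra _ _ xy) (ra' _ _ xy).
- apply: contra w0 => /eqP ww; apply/eqP/matrixP => i k; rewrite mxE.
  have [j w'j] : exists j, w' j 0 != 0.
    apply/existsP; apply: contraR w0'; rewrite negb_exists => /forallP h.
    apply/eqP/matrixP => j l; rewrite ord1 mxE; apply/eqP.
    by have := h j; rewrite negbK.
  have := tensmxE w w' i j k 0; rewrite ww mxE => /esym/eqP.
  by rewrite mulf_eq0 (negbTE w'j) orbF => /eqP.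
- move=> i t; rewrite /tensor_rep mulmxDl !tensmx_mul_col aX aX'.
  by rewrite tens0mx tensmx0 addr0.
- move=> j t; rewrite /tensor_rep mulmxDl !tensmx_mul_col aI aI' !mul1mx.
  by rewrite tensmxZl tensmxZr -scalerDl.
Qed.

(** One-dimensional modules on which the X act by zero: the condition is what
remains of the bracket of X^+_i with X^-_i. *)
Lemma realizable_scalar u :
  (forall i t, u (ord_this i) t - u (ord_next i) t =
     Q i * (u (ord_this i) t.+1 - u (ord_next i) t.+1)) ->
  realizable u.
Proof.
move=> h; exists 1%N, (fun g => if g is GI j t then (u j t)%:M else 0), 1%:M.
split=> [x y []||i t|j t] /=.
- by move=> i j s t; rewrite -!scalar_mxM mulrC subrr.
- by move=> b j i s t; rewrite mulmx0 mul0mx subrr scaler0.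
- move=> i j s t; rewrite mulmx0 subrr; case: eqP => //= _.
  by rewrite -!raddfB /= h scale_scalar_mx subrr.
- by move=> *; rewrite mulmx0 subrr.
- by move=> *; rewrite !mulmx0 subrr.
- by move=> *; rewrite !mulmx0 !mul0mx subrr.
- by apply/eqP => /matrixP/(_ 0 0)/eqP; rewrite !mxE eqxx oner_eq0.
- by rewrite mul0mx.
- by rewrite mulmx1 scalemx1.
Qed.

Section Vector.
Variables (u : 'I_m -> nat -> F) (N : nat) (a : gl_gen m -> 'M[F]_N) (w : 'cV[F]_N).
Hypotheses (ra : matrix_rep Q a) (w0 : w != 0).
Hypothesis aX : forall i t, a (GX true i t) *m w = 0.
Hypothesis aI : forall j t, a (GI j t) *m w = u j t *: w.

Let J : {pred U^o} := fun x => rep_eval a (x : U) *m w == 0.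

Fact annihilator_closed : submod_closed J.
Proof.
split=> [|c x y]; first by rewrite unfold_in /J rep_eval0 // mul0mx.
rewrite !unfold_in /J => /eqP xw /eqP yw.
by rewrite rep_evalD // rep_evalM // mulmxDl -mulmxA xw yw mulmx0 addr0.
Qed.

Fact annihilator_rels x : verma_rels u x -> x \in J.
Proof.
case=> [[i [t ->]]|[j [t ->]]]; rewrite unfold_in /J.
  by rewrite rep_evalX // aX.
rewrite -scaleN1r rep_evalD // !rep_evalZ // rep_evalI // rep_eval1 //.
by rewrite scaleN1r mulmxBl aI -scalemxAl mul1mx subrr.
Qed.

Fact annihilator_proper : (1 : U^o) \notin J.
Proof. by rewrite unfold_in /J rep_eval1 // mul1mx. Qed.

Lemma rep_verma_neq0 : verma_vector Q u != 0.
Proof.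
exact: verma_vector_neq0 annihilator_closed annihilator_rels annihilator_proper.
Qed.

Definition orbit_mx n (x : 'I_n -> U) : 'M[F]_(n, N) :=
  \matrix_(i < n) (rep_eval a (x i) *m w)^T.

(** The x_i are chosen to maximize the rank of the vectors x_i w: one more
vector cannot increase it. *)
Lemma orbit_basis : exists n (x : 'I_n -> U), forall y : U, exists c : 'I_n -> F,
  rep_eval a y *m w = \sum_i c i *: (rep_eval a (x i) *m w).
Proof.
pose P k := `[< exists n (x : 'I_n -> U), \rank (orbit_mx x) = k >].
have exP : exists k, P k.
  by exists (\rank (orbit_mx (fun _ : 'I_0 => 0))); apply/asboolP; exists 0%N, (fun _ => 0).
have bP k : P k -> (k <= N)%N by move=> /asboolP[n [x <-]]; exact: rank_leq_col.
have [k /asboolP[n [x rk]] kmax] := ex_maxnP exP bP.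
exists n, x => y; pose x' (i : 'I_n.+1) := oapp x y (unlift ord0 i).
have sub : (orbit_mx x <= orbit_mx x')%MS.
  apply/row_subP => i; apply: (eq_row_sub (lift ord0 i)).
  by rewrite !rowK /x' liftK.
have le : (\rank (orbit_mx x') <= \rank (orbit_mx x))%N.
  by rewrite rk; apply: kmax; apply/asboolP; exists n.+1, x'.
have : (orbit_mx x' <= orbit_mx x)%MS.
  by rewrite -(geq_leqif (mxrank_leqif_sup sub)).
move=> /row_subP/(_ ord0); rewrite rowK /x' unlift_none /= => /submxP[c e].
exists (fun i => c 0 i); apply: trmx_inj; rewrite e mulmx_sum_row linear_sum /=.
by apply: eq_bigr => i _; rewrite rowK linearZ.
Qed.

(** If y - sum c_i x_i kills w, it maps the generator of the Verma module into
the radical; so the x_i applied to the generator of L(u) span. *)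
Lemma rep_simple_hw_fd : finite_dimensional (simple_hw Q u).
Proof.
have [n [x xP]] := orbit_basis.
exists n, (fun i => x i *: simple_hw_vector Q u) => v.
have [y ->] := simple_hw_generates v; have [c e] := xP y; exists c.
apply/eqP; rewrite -subr_eq0; apply/eqP.
under eq_bigr do rewrite scalerA mulr_algl.
rewrite -scaler_suml -scalerBl simple_hw_vectorE; apply/quot_proj0P.
apply: left_ideal_rad annihilator_closed annihilator_rels annihilator_proper _ _.
rewrite unfold_in /J -scaleN1r rep_evalD // rep_evalZ // scaleN1r mulmxBl e.
rewrite (big_morph (rep_eval a) (rep_evalD ra) (rep_eval0 ra)) mulmx_suml.
by under [X in _ - X]eq_bigr do rewrite rep_evalZ // -scalemxAl; rewrite subrr.
Qed.

End Vector.

Lemma realizable_simple_hw u : realizable u ->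
  verma_vector Q u != 0 /\ finite_dimensional (simple_hw Q u).
Proof.
move=> [N [a [w [ra w0 aX aI]]]].
by split; [exact: rep_verma_neq0 aI | exact: rep_simple_hw_fd aI].
Qed.

End Realizable.

(** * Evaluations of the exterior algebra *)

Section WeightedMaps.
Variables (F : comNzRingType) (T : finType).

(** The operator psi |-> (x |-> c x * psi (s x)) on functions on T. Products of
such operators are again of this form, which reduces identities between them to
statements about maps of T. *)
Definition wmap_mx (c : T -> F) (s : T -> T) : 'M[F]_#|T| :=
  \matrix_(i, j) (c (enum_val i) * (enum_val j == s (enum_val i))%:R).

Lemma eq_wmap_mx c c' s s' : (forall x, c x = c' x) ->
  (forall x, c x != 0 -> s x = s' x) -> wmap_mx c s = wmap_mx c' s'.
Proof.
move=> cc ss; apply/matrixP => i j; rewrite !mxE -cc.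
have [->|/ss ->//] := eqVneq (c (enum_val i)) 0; by rewrite !mul0r.
Qed.

Lemma mul_wmap_mx c c' s s' :
  wmap_mx c s *m wmap_mx c' s' = wmap_mx (fun x => c x * c' (s x)) (s' \o s).
Proof.
apply/matrixP => i j; rewrite !mxE (bigD1 (enum_rank (s (enum_val i)))) //= big1.
  by rewrite !mxE enum_rankK eqxx mulr1 addr0 mulrA.
move=> k ki; rewrite !mxE (_ : _ == _ = false) ?mulr0 ?mul0r //.
by apply: contraNF ki => /eqP <-; rewrite enum_valK.
Qed.

Lemma wmap_mx0 c s : (forall x, c x = 0) -> wmap_mx c s = 0.
Proof. by move=> c0; apply/matrixP => i j; rewrite !mxE c0 mul0r. Qed.

Lemma scale_wmap_mx a c s : a *: wmap_mx c s = wmap_mx (fun x => a * c x) s.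
Proof. by apply/matrixP => i j; rewrite !mxE mulrA. Qed.

Lemma sub_wmap_mx c c' s : wmap_mx c s - wmap_mx c' s = wmap_mx (fun x => c x - c' x) s.
Proof. by apply/matrixP => i j; rewrite !mxE mulrBl. Qed.

Definition basis_col (x : T) : 'cV[F]_#|T| := \col_i (enum_val i == x)%:R.

Lemma wmap_mx_col c s y : wmap_mx c s *m basis_col y =
  \col_i (c (enum_val i) * (s (enum_val i) == y)%:R).
Proof.
apply/matrixP => i j; rewrite !mxE (bigD1 (enum_rank (s (enum_val i)))) //= big1.
  by rewrite !mxE enum_rankK eqxx mulr1 addr0.
move=> k ki; rewrite !mxE (_ : _ == s _ = false) ?mulr0 ?mul0r //.
by apply: contraNF ki => /eqP <-; rewrite enum_valK.
Qed.

Lemma basis_col_neq0 x : basis_col x != 0.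
Proof.
apply/eqP => /matrixP/(_ (enum_rank x) 0)/eqP.
by rewrite !mxE enum_rankK eqxx oner_eq0.
Qed.

End WeightedMaps.

Lemma tperm_disjointC (T : finType) (a b c d x : T) :
  a != c -> a != d -> b != c -> b != d ->
  tperm a b (tperm c d x) = tperm c d (tperm a b x).
Proof.
move=> ac ad bc bd; case: (tpermP c d x) => [->|->|/eqP xc /eqP xd].
- by rewrite (tpermD ad bd) (tpermD ac bc) tpermL.
- by rewrite (tpermD ac bc) (tpermD ad bd) tpermR.
by case: (tpermP a b x) => [_|_|_ _]; rewrite tpermD // eq_sym.
Qed.

Section ExteriorAlgebra.
Variables (m : nat) (F : numFieldType) (Q : 'I_m.-1 -> F).
Local Notation T := {set 'I_m}.

(** A set S of indices stands for the exterior product of the basis vectors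
that it lists, and X_i exchanges i and i + 1 in S. No signs occur, because
neighbours in the increasing order are exchanged. *)
Definition swap_next (i : 'I_m.-1) (S : T) : T :=
  [set x | tperm (ord_this i) (ord_next i) x \in S].

Definition movable (b : bool) (i : 'I_m.-1) (S : T) : bool :=
  ((ord_this i \in S) == b) && ((ord_next i \in S) == ~~ b).

Definition hop b i : 'M[F]_#|T| :=
  wmap_mx (fun S : T => (movable b i S)%:R) (swap_next i).

Definition occupation (j : 'I_m) : 'M[F]_#|T| :=
  wmap_mx (fun S : T => (j \in S)%:R) id.

Lemma in_swap_next i S x :
  (x \in swap_next i S) = (tperm (ord_this i) (ord_next i) x \in S).
Proof. by rewrite inE. Qed.

Lemma this_swap i S : (ord_this i \in swap_next i S) = (ord_next i \in S).
Proof. by rewrite inE tpermL. Qed.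
Lemma next_swap i S : (ord_next i \in swap_next i S) = (ord_this i \in S).
Proof. by rewrite inE tpermR. Qed.
Lemma swap_nextK i : involutive (swap_next i).
Proof. by move=> S; apply/setP => x; rewrite !inE tpermK. Qed.

Lemma occupation_comm i j : occupation i *m occupation j = occupation j *m occupation i.
Proof. by rewrite !mul_wmap_mx; apply: eq_wmap_mx => //= S; rewrite mulrC. Qed.

Lemma occupation_hop j b i :
  occupation j *m hop b i - hop b i *m occupation j =
  (pm F b * cartan' F j i) *: hop b i.
Proof.
rewrite !mul_wmap_mx sub_wmap_mx scale_wmap_mx; apply: eq_wmap_mx => //= S.
rewrite cartan'E /movable.
have [->|jt] := eqVneq j (ord_this i).
  rewrite this_swap -val_eqE /= ltn_eqF // /pm.
  by case: b; case: (_ \in S); case: (_ \in S) => /=; ring.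
have [->|jn] := eqVneq j (ord_next i).
  rewrite next_swap /pm.
  by case: b; case: (_ \in S); case: (_ \in S) => /=; ring.
rewrite in_swap_next tpermD 1?eq_sym //.
by ring.
Qed.

Lemma hop_up_down i :
  hop true i *m hop false i - hop false i *m hop true i =
  occupation (ord_this i) - occupation (ord_next i).
Proof.
have e b : hop b i *m hop (~~ b) i = wmap_mx (fun S : T => (movable b i S)%:R) id.
  rewrite mul_wmap_mx; apply: eq_wmap_mx => [S|S _] /=; last exact: swap_nextK.
  rewrite /movable this_swap next_swap.
  by case: b; case: (_ \in S); case: (_ \in S); rewrite /= ?mulr0 ?mulr1.
rewrite (e true) (e false) !sub_wmap_mx; apply: eq_wmap_mx => //= S.
rewrite /movable; by case: (_ \in S); case: (_ \in S); rewrite /= ?subrr ?subr0.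
Qed.

Lemma hop_comm b b' i j : i != j -> ~~ adjacent i j ->
  hop b i *m hop b' j = hop b' j *m hop b i.
Proof.
rewrite /adjacent negb_or -val_eqE => ij /andP[ji1 ij1].
have neq : [/\ ord_this i != ord_this j, ord_this i != ord_next j,
    ord_next i != ord_this j & ord_next i != ord_next j].
  by rewrite -!val_eqE /= eqSS; split=> //; rewrite eq_sym.
case: neq => n1 n2 n3 n4.
rewrite !mul_wmap_mx; apply: eq_wmap_mx => [S|S _] /=.
  by rewrite mulrC /movable !in_swap_next !tpermD // 1?eq_sym.
apply/setP => x; rewrite !inE.
by rewrite tperm_disjointC // eq_sym.
Qed.

(** The second factor leaves the common index in the state which the first one
does not accept. *)
Lemma hop_up_down0 b i j : adjacent i j -> hop b i *m hop (~~ b) j = 0.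
Proof.
rewrite /adjacent mul_wmap_mx => aij; apply: wmap_mx0 => S.
rewrite /movable; case/orP: aij => /eqP e.
  have -> : ord_this j = ord_next i by exact/val_inj.
  by rewrite next_swap; case: (_ \in S); case: b; rewrite /= ?(mul0r, mulr0, andbF) //= mul0r.
have -> : ord_next j = ord_this i by exact/val_inj.
rewrite this_swap; case: (ord_next i \in S); case: b; rewrite /= ?(mul0r, mulr0, andbF) //=.
Qed.

Lemma hop_sqr0 b i : hop b i *m hop b i = 0.
Proof.
rewrite mul_wmap_mx; apply: wmap_mx0 => S; rewrite /movable this_swap next_swap.
by case: b; case: (_ \in S); case: (_ \in S); rewrite /= ?mulr0 ?mul0r.
Qed.

(** Repeating the exchange i with i + 1 would require restoring the index that
is not shared with j, which the exchange for j leaves untouched. *)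
Lemma hop_sandwich0 b i j : adjacent i j -> hop b i *m hop b j *m hop b i = 0.
Proof.
rewrite /adjacent !mul_wmap_mx => aij; apply: wmap_mx0 => S /=.
rewrite /movable; case/orP: aij => /eqP e.
  have n1 : ord_this i != ord_this j by rewrite -val_eqE /= e ltn_eqF.
  have n2 : ord_this i != ord_next j by rewrite -val_eqE /= e ltn_eqF.
  rewrite [ord_this i \in swap_next _ _]in_swap_next tpermD // 1?eq_sym // this_swap.
  by case: b; case: (ord_next i \in S); rewrite /= ?(andbF, mulr0, mul0r).
have n1 : ord_next i != ord_this j by rewrite -val_eqE /= e gtn_eqF.
have n2 : ord_next i != ord_next j by rewrite -val_eqE /= e gtn_eqF.
rewrite [ord_next i \in swap_next _ _]in_swap_next tpermD // 1?eq_sym // next_swap.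
by case: b; case: (ord_this i \in S); rewrite /= ?(andbF, mulr0, mul0r).
Qed.

Variable g : F.

(** The factor 1 - Q_i g goes to the X^+ only; this turns the bracket of X^+
and X^- of the undeformed algebra into the deformed one. *)
Definition hop_coef (b : bool) (i : 'I_m.-1) (t : nat) : F :=
  (if b then 1 - Q i * g else 1) * g ^+ t.

Definition exterior_rep (x : gl_gen m) : 'M[F]_#|T| :=
  match x with
  | GX b i t => hop_coef b i t *: hop b i
  | GI j t => g ^+ t *: occupation j
  end.

Lemma commutatorZ n c d (A B : 'M[F]_n) :
  (c *: A) *m (d *: B) - (d *: B) *m (c *: A) = (c * d) *: (A *m B - B *m A).
Proof.
by rewrite -!scalemxAl -!scalemxAr !scalerA [d * c]mulrC -scalerBr.
Qed.

Lemma exterior_repP : matrix_rep Q exterior_rep.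
Proof.
move=> x y [] /=.
- by move=> i j s t; rewrite commutatorZ occupation_comm subrr scaler0.
- move=> b j i s t; rewrite commutatorZ occupation_hop !scalerA /hop_coef exprD.
  by congr (_ *: _); case: b; ring.
- move=> i j s t; rewrite commutatorZ /hop_coef mul1r.
  have [<-|ij] := eqVneq i j.
    rewrite hop_up_down /= -!scalerBr scalerA -scalerBl exprS exprD.
    by congr (_ *: _); ring.
  have [aij|naij] := boolP (adjacent i j).
    rewrite (hop_up_down0 true aij) (@hop_up_down0 false) ?subrr ?scaler0 //.
    by rewrite /adjacent orbC.
  by rewrite (hop_comm true false ij naij) subrr scaler0.
- move=> b i j s t naij; rewrite commutatorZ; have [->|ij] := eqVneq i j.
    by rewrite subrr scaler0.
  by rewrite (hop_comm b b ij naij) subrr scaler0.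
- move=> b i j s t aij; rewrite !commutatorZ; congr (_ *: _).
  by rewrite /hop_coef !exprS; ring.
- move=> b i j s t r aij; rewrite commutatorZ commutatorZ mulmxBr mulmxBl !mulmxA.
  rewrite hop_sqr0 mul0mx hop_sandwich0 // -mulmxA hop_sqr0 mulmx0.
  by rewrite !subrr scaler0.
Qed.

(** The highest weight vector is the exterior product of the first basis
vectors, up to the index k: X^+_i would need i + 1 present and i absent. *)
Lemma realizable_fundamental (k : 'I_m.-1) :
  realizable Q (fun j t => (j <= k)%N%:R * g ^+ t).
Proof.
pose S0 : T := [set j : 'I_m | (j <= k)%N].
exists #|T|, exterior_rep, (basis_col F S0); split.
- exact: exterior_repP.
- exact: basis_col_neq0.
- move=> i t; rewrite /= -scalemxAl wmap_mx_col; apply/matrixP => r c; rewrite !mxE.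
  case: eqP => [e|_]; last by rewrite !mulr0.
  have e1 := this_swap i (enum_val r); have e2 := next_swap i (enum_val r).
  rewrite e !inE /= in e1 e2; rewrite /movable -e1 -e2.
  by case: (ltnP i k) => ik; rewrite ?(ltnW ik) /= ?andbF ?mul0r ?mulr0.
- move=> j t; rewrite /= -scalemxAl wmap_mx_col; apply/matrixP => r c; rewrite !mxE.
  case: eqP => [->|_]; last by rewrite !mulr0.
  by rewrite inE !mulr1 mulrC.
Qed.

End ExteriorAlgebra.

Section RealizeParameters.
Variables (m : nat) (F : numClosedFieldType) (Q : 'I_m.-1 -> F).

Lemma realizable_sum (I : Type) (r : seq I) (f : I -> 'I_m -> nat -> F) :
  (forall x, realizable Q (f x)) ->
  realizable Q (fun j t => \sum_(x <- r) f x j t).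
Proof.
move=> h; elim: r => [|x r IH].
  by apply: realizable_scalar => i t; rewrite !big_nil subrr mulr0.
by apply: realizable_ext (realizableD (h x) IH) => j t; rewrite big_cons.
Qed.

(** The one-dimensional factor [lin] takes care of beta and h, since Q_i^{-t}
is the geometric sequence that the bracket of X^+_i and X^-_i annihilates. *)
Lemma realizable_ut_weight (p : parameters F m) :
  parameter_set Q p -> realizable Q (ut_weight Q p).
Proof.
move=> pQ.
pose lin j t := \sum_(k < m.-1) (j <= k)%N%:R * ((Q k)^-1 ^+ t * (p.1 k).2) + p.2 t.
pose ev (k : 'I_m.-1) (j : 'I_m) (t : nat) :=
  \sum_(g <- roots_of (p.1 k).1) (j <= k)%N%:R * g ^+ t.
have rl : realizable Q (fun j : 'I_m => lin j).
  apply: realizable_scalar => i t.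
  have dif s : lin (ord_this i) s - lin (ord_next i) s = (Q i)^-1 ^+ s * (p.1 i).2.
    rewrite /lin [X in X - _]addrC [X in _ - X]addrC opprD addrACA subrr add0r -sumrB.
    rewrite (bigD1 i) //= leqnn ltnn mul1r mul0r subr0 big1 ?addr0 // => k ki.
    by rewrite ltn_neqAle eq_sym val_eqE ki subrr.
  rewrite !dif; have [_] := pQ i; rewrite /Bset; have [_ /= ->|Q0 _] := eqVneq.
    by rewrite !mulr0.
  by rewrite exprS !mulrA mulfV // mul1r.
have re : realizable Q (fun j t => \sum_(k <- enum 'I_m.-1) ev k j t).
  by apply: realizable_sum => k; apply: realizable_sum => g; exact: realizable_fundamental.
apply: realizable_ext (realizableD rl re) => j t.
rewrite /lin /ut_weight /ev big_enum /= addrAC -big_split /=; congr (_ + _).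
rewrite [RHS]big_mkcond /=.
apply: eq_bigr => k _; have [M B] := pQ k.
rewrite u_weightE // -mulr_sumr -mulrDr; case: (j <= k)%N.
  by rewrite mul1r addrC.
by rewrite mul0r.
Qed.

End RealizeParameters.

(** * Highest weight vectors in finite dimensional modules *)

Lemma eigenvalue_progression (F : numFieldType) n (A : 'M[F]_n) (c d : F) :
  d != 0 -> exists k : nat, ~~ eigenvalue A (c + k%:R * d).
Proof.
move=> d0; apply: contrapT => h.
have h' k : eigenvalue A (c + k%:R * d).
  by apply: contraT => hk; case: h; exists k.
pose rs := [seq c + k%:R * d | k <- iota 0 n.+1].
suff : (size rs < size (char_poly A))%N.
  by rewrite size_char_poly size_map size_iota ltnn.
apply: max_poly_roots.
- by rewrite -size_poly_gt0 size_char_poly.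
- by apply/allP => _ /mapP[k _ ->]; rewrite -eigenvalue_root_char.
- rewrite map_inj_uniq ?iota_uniq // => k l /addrI/(mulIf d0)/eqP.
  by rewrite eqr_nat => /eqP.
Qed.

Lemma exists_eigenvalue (F : closedFieldType) n (A : 'M[F]_n) :
  (0 < n)%N -> exists c, eigenvalue A c.
Proof.
move=> n0; have /closed_rootP[c] : size (char_poly A) != 1.
  by rewrite size_char_poly eqSS -lt0n.
by rewrite -eigenvalue_root_char; exists c.
Qed.

Lemma exists_eigenvalue_stable (F : closedFieldType) n (W A : 'M[F]_n) :
  W != 0 -> stablemx W A -> exists c, (W :&: eigenspace A c)%MS != 0.
Proof.
move=> W0; rewrite -stablemx_row_base => /submxP[A' e].
have [|c /eigenvalueP[v vA v0]] := exists_eigenvalue A'.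
  by rewrite lt0n mxrank_eq0.
exists c; apply/rowV0Pn; exists (v *m row_base W).
  rewrite sub_capmx -(eq_row_base W) submxMl /=.
  by apply/eigenspaceP; rewrite -mulmxA e mulmxA vA scalemxAl.
by rewrite mulmx_free_eq0 // row_base_free.
Qed.

(** Among the nonzero stable subspaces take one of least dimension:
intersecting it with an eigenspace of one of the operators gives a stable
subspace, which must be the whole. This works for an infinite commuting family.
*)
Lemma common_eigenspace (F : closedFieldType) n (I : Type) (W : 'M[F]_n)
    (A : I -> 'M[F]_n) :
  W != 0 -> (forall i, stablemx W (A i)) ->
  (forall i j, A i *m A j = A j *m A i) ->
  exists2 W' : 'M[F]_n, W' != 0 & (W' <= W)%MS /\
    forall i, exists c, (W' <= eigenspace (A i) c)%MS.
Proof.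
move=> W0 Wst Acomm.
pose P r := `[< exists W' : 'M[F]_n, [/\ \rank W' = r, W' != 0, (W' <= W)%MS &
  forall i, stablemx W' (A i)] >].
have exP : exists r, P r by exists (\rank W); apply/asboolP; exists W.
have [r /asboolP[W' [rW W'0 W'W W'st]] rmin] := ex_minnP exP.
exists W' => //; split=> // i.
have [c cap0] := exists_eigenvalue_stable W'0 (W'st i); exists c.
suff : (W' <= W' :&: eigenspace (A i) c)%MS by rewrite sub_capmx => /andP[].
rewrite -(geq_leqif (mxrank_leqif_sup (capmxSl _ _))) rW; apply: rmin.
apply/asboolP; exists (W' :&: eigenspace (A i) c)%MS; split=> //.
  exact: submx_trans (capmxSl _ _) W'W.
move=> j; rewrite sub_capmx (submx_trans (submxMr _ (capmxSl _ _)) (W'st j)) /=.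
apply: submx_trans (submxMr _ (capmxSr _ _)) _.
by apply: comm_mx_stable_eigenspace; exact: Acomm.
Qed.

Section FiniteDimensional.
Variables (m : nat) (F : numClosedFieldType) (Q : 'I_m.-1 -> F).
Local Notation U := (Ugl Q).
Variable V : lmodType U.

Definition combination n (e : 'I_n -> V) (c : 'rV[F]_n) : V :=
  \sum_i (c 0 i)%:A *: e i.

Lemma combinationD n (e : 'I_n -> V) c d :
  combination e (c + d) = combination e c + combination e d.
Proof.
by rewrite -big_split; apply: eq_bigr => i _; rewrite mxE fscaleDl.
Qed.

Lemma combinationZ n (e : 'I_n -> V) a c :
  combination e (a *: c) = a%:A *: combination e c.
Proof.
by rewrite scaler_sumr; apply: eq_bigr => i _; rewrite mxE fscaleA.
Qed.

Lemma combination0 n (e : 'I_n -> V) : combination e 0 = 0.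
Proof. by apply: big1 => i _; rewrite mxE !scale0r. Qed.

(** A spanning family of least size: a relation between its members would allow
one to be dropped. *)
Lemma fd_basis : finite_dimensional V ->
  exists n (e : 'I_n -> V), (forall v, exists c, v = combination e c) /\
    (forall c, combination e c = 0 -> c = 0).
Proof.
move=> fd.
pose P n := `[< exists e : 'I_n -> V, forall v, exists c, v = combination e c >].
have exP : exists n, P n.
  have [n [e eP]] := fd; exists n; apply/asboolP; exists e => v.
  have [c ->] := eP v; exists (\row_i c i).
  by apply: eq_bigr => i _; rewrite mxE.
have [n /asboolP[e eP] nmin] := ex_minnP exP.
exists n, e; split=> // c; case: n e c eP nmin => [|n] e c eP nmin ce.
  by apply/rowP => -[].
apply/eqP; apply: contraT => /rV0Pn[i ci].
have : P n.
  apply/asboolP; exists (e \o lift i) => v; have [d ->] := eP v.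
  exists (\row_k (d 0 (lift i k) - d 0 i / c 0 i * c 0 (lift i k))).
  have -> : combination e d = combination e (d - (d 0 i / c 0 i) *: c).
    by rewrite combinationD -scaleNr combinationZ ce scaler0 addr0.
  rewrite /combination (bigD1_ord i) //= !mxE divfK // subrr !scale0r add0r.
  by apply: eq_bigr => k _; rewrite !mxE.
by move/nmin; rewrite ltnn.
Qed.

Lemma fd_coordinates : finite_dimensional V ->
  exists n (phi : 'rV[F]_n -> V) (M : U -> 'M[F]_n),
  [/\ forall v, exists c, v = phi c, injective phi,
      forall c d, phi (c + d) = phi c + phi d,
      forall a c, phi (a *: c) = a%:A *: phi c &
      forall x c, x *: phi c = phi (c *m M x)].
Proof.
move=> /fd_basis[n [e [eP e0]]].
have [co coP] := choice eP.
exists n, (combination e), (fun x => \matrix_i co (x *: e i)); split=> //.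
- move=> c d cd; apply/eqP; rewrite -subr_eq0; apply/eqP/e0.
  by rewrite combinationD cd -combinationD subrr combination0.
- exact: combinationD.
- exact: combinationZ.
- move=> x c; rewrite mulmx_sum_row.
  rewrite (big_morph _ (combinationD e) (combination0 e)).
  rewrite scaler_sumr; apply: eq_bigr => i _.
  by rewrite combinationZ rowK -coP fscale_comm.
Qed.

(** The eigenvalues c, c + 1, c + 2, ... of the grading cannot go on for ever.
Above the last one, X^+ has nowhere to go; the I's commute with the grading and
have a common eigenvector in that last eigenspace. *)
Lemma fd_hw_vector : finite_dimensional V -> (exists v : V, v != 0) ->
  exists u, exists2 v : V, v != 0 & hw_vector u v.
Proof.
move=> /fd_coordinates[n [phi [M [phi_surj phi_inj phiD phiZ phiM]]]] [v1 v10].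
have phi0 : phi 0 = 0 by rewrite -(scale0r 0) phiZ !scale0r.
have MM x y : M (x * y) = M y *m M x.
  apply/row_matrixP => i; rewrite !rowE; apply: phi_inj.
  by rewrite -phiM -scalerA !phiM mulmxA.
have eigP x c a : x *: phi c = a%:A *: phi c -> c != 0 -> eigenvalue (M x) a.
  move=> e c0; apply/eigenvalueP; exists c => //.
  by apply: phi_inj; rewrite -phiM e phiZ.
have n0 : (0 < n)%N.
  have [c v1c] := phi_surj v1; have /rV0Pn[i _] : c != 0.
    by apply: contraNneq v10 => c0; rewrite v1c c0 phi0.
  exact: leq_ltn_trans (ltn_ord i).
have [l0 el0] := exists_eigenvalue (M (grading Q)) n0.
have [k kP kmin] : exists2 k, ~~ eigenvalue (M (grading Q)) (l0 + k%:R) &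
    forall k', ~~ eigenvalue (M (grading Q)) (l0 + k'%:R) -> (k <= k')%N.
  have ex : exists k, ~~ eigenvalue (M (grading Q)) (l0 + k%:R).
    have [k kP] := eigenvalue_progression (M (grading Q)) l0 (oner_neq0 F).
    by exists k; rewrite -[k%:R]mulr1.
  by have [k kP kmin] := ex_minnP ex; exists k.
case: k kP kmin => [|k] kP kmin; first by rewrite addr0 el0 in kP.
have el : eigenvalue (M (grading Q)) (l0 + k%:R).
  by apply: contraT => /kmin; rewrite ltnn.
set l := l0 + k%:R in el.
pose W := eigenspace (M (grading Q)) l.
have [p|p q|W' W'0 [W'W W'e]] := @common_eigenspace F n ('I_m * nat) W
    (fun p => M (UI Q p.1 p.2)) el.
- by apply: comm_mx_stable_eigenspace; rewrite /comm_mx -!MM grading_UI.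
- by rewrite -!MM UI_comm.
have [u uP] := choice W'e.
have /rowV0Pn[c cW' c0] := W'0.
exists (fun j t => u (j, t)), (phi c); first by apply: contra c0 => /eqP e; apply/eqP/phi_inj; rewrite e.
split=> [i t|j t].
- have [d dE] := phi_surj (UX Q true i t *: phi c).
  rewrite dE; have [->//|d0] := eqVneq d 0.
  have gc : grading Q *: phi c = l%:A *: phi c.
    by rewrite phiM (eigenspaceP (submx_trans cW' W'W)) phiZ.
  case/negP: kP; apply: eigP d0; rewrite -dE scalerA grading_UX scalerDl -scalerA.
  by rewrite gc fscale_comm -[k.+1]addn1 natrD addrA -/l [RHS]fscaleDl /pm !scale1r.
- by rewrite phiM (eigenspaceP (submx_trans cW' (uP (j, t)))) phiZ.
Qed.

Lemma fd_lowering (x : U) (v : V) (c : F) :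
  finite_dimensional V -> grading Q * x = x * grading Q - x ->
  grading Q *: v = c%:A *: v ->
  exists k, forall s, (k <= s)%N -> x ^+ s *: v = 0.
Proof.
move=> /fd_coordinates[n [phi [M [phi_surj phi_inj phiD phiZ phiM]]]] gx gv.
have phi0 : phi 0 = 0 by rewrite -(scale0r 0) phiZ !scale0r.
have [|k kP] := @eigenvalue_progression F n (M (grading Q)) c (-1).
  by rewrite oppr_eq0 oner_eq0.
have gxs s : grading Q *: (x ^+ s *: v) = (c + s%:R * -1)%:A *: (x ^+ s *: v).
  elim: s => [|s IH]; first by rewrite mul0r addr0 !scale1r.
  rewrite exprS -!scalerA [LHS]scalerA gx scalerBl -scalerA IH fscale_comm.
  by rewrite -[s.+1]addn1 natrD mulrDl mul1r addrA fscaleBl !scale1r.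
have xk : x ^+ k *: v = 0.
  have [d dE] := phi_surj (x ^+ k *: v); rewrite dE.
  have [->//|d0] := eqVneq d 0; case/negP: kP; apply/eigenvalueP; exists d => //.
  by apply: phi_inj; rewrite -phiM -dE gxs dE phiZ.
by exists k => s ks; rewrite -(subnK ks) exprD -scalerA xk scaler0.
Qed.

End FiniteDimensional.

(** * Newton's identities from raising and lowering operators *)

Section Shift.
Variable M : zmodType.

(** Multiplication by z^(n+1) on sequences viewed as power series; indices are
shifted by one because the lowering operators X_n come with z^(n+1). *)
Definition shift n (f : nat -> M) s : M :=
  if (n < s)%N then f (s - n.+1)%N else 0.

Lemma shift_ge n f s : (s <= n)%N -> shift n f s = 0.
Proof. by rewrite /shift ltnNge => ->. Qed.

Lemma shift_shift k l f s : shift k (shift l f) s = shift (k + l).+1 f s.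
Proof.
rewrite /shift.
have -> : ((k + l).+1 < s)%N = (k < s)%N && (l < s - k.+1)%N by lia.
case: (k < s)%N => //=; case: (l < s - k.+1)%N => //.
by congr f; lia.
Qed.

Lemma shiftC k l f s : shift k (shift l f) s = shift l (shift k f) s.
Proof. by rewrite !shift_shift addnC. Qed.

(** The pairs (k, l) with k + l + 1 = n are n in number. *)
Lemma sum_shift_index (g : nat -> M) N : (forall n, (N <= n)%N -> g n = 0) ->
  \sum_(k < N) \sum_(l < N) g (k + l).+1 = \sum_(n < N) g n *+ n.
Proof.
move=> gN.
have inner (k : 'I_N) : \sum_(l < N) g (k + l).+1 = \sum_(n < N | (k < n)%N) g n.
  rewrite -(big_mkord xpredT (fun l => g (k + l).+1)).
  have -> : \sum_(0 <= l < N) g (k + l).+1 = \sum_(k.+1 <= n < N + k.+1) g n.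
    rewrite -{1}[k.+1]add0n big_addn addnK; apply: eq_bigr => l _.
    by rewrite addnS addnC.
  have tail : \sum_(N <= n < N + k.+1) g n = 0.
    by rewrite big_nat_cond big1 // => n /andP[/andP[/gN]].
  rewrite (big_cat_nat (n := N)) ?leq_addr //= tail [LHS]addr0.
  by rewrite (big_nat_widenl _ 0) // big_mkord.
under eq_bigr do rewrite inner.
rewrite (exchange_big_dep xpredT) //=; apply: eq_bigr => n _.
by rewrite -(big_ord_widen N (fun _ => g n) (ltnW (ltn_ord n))) sumr_const card_ord.
Qed.

End Shift.

Section ShiftSum.
Variables (F : pzRingType) (V : lmodType F).

Lemma shiftZ n a (f : nat -> V) s : shift n (fun t => a *: f t) s = a *: shift n f s.
Proof. by rewrite /shift; case: ifP; rewrite ?scaler0. Qed.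

Lemma shift_sum n (I : Type) (r : seq I) (f : I -> nat -> V) s :
  shift n (fun t => \sum_(i <- r) f i t) s = \sum_(i <- r) shift n (f i) s.
Proof. by rewrite /shift; case: ifP => // _; rewrite big1. Qed.

Lemma eq_shift n (f g : nat -> V) s : (forall t, (t <= s)%N -> f t = g t) ->
  shift n f s = shift n g s.
Proof.
by move=> fg; rewrite /shift; case: ifP => // ns; apply: fg; exact: leq_subr.
Qed.

End ShiftSum.

(** In terms of generating series, z e'(z) = h(z) e(z) with h(z) = sum_n (-1)^n
h_n z^(n+1): the e_s are the elementary symmetric functions of a family whose
power sum of exponent n + 1 is h_n. *)
Definition newton (F : pzRingType) (h e : nat -> F) := forall N s, (s <= N)%N ->
  s%:R * e s = \sum_(n < N) (-1) ^+ n * h n * shift n e s.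

(** With X(z) = sum_n (-1)^n X_n z^(n+1) and e(z) = sum_s e_s z^s, the vectors
[divided d s] are the coefficients of z^s in X(z)^d/d! e(z) v0. The commutation
relations say that H(z) X(z) - X(z) H(z) = 2 (z X'(z) - X(z)), and with z e' =
h e they make E act on these series as z d/dz - (d - 1) from d to d - 1. The
sums are cut off at N, which is harmless for coefficients of degree at most N.
*)
Section CurrentSl2.
Variables (F : numFieldType) (V : lmodType F).
Variables (E : {linear V -> V}) (X H : nat -> {linear V -> V}).
Hypothesis EX : forall n v, E (X n v) = X n (E v) + H n v.
Hypothesis HX : forall n k v, H n (X k v) = X k (H n v) - 2%:R *: X (n + k).+1 v.
Hypothesis XX : forall n k v, X n (X k v) = X k (X n v).
Variables (v0 : V) (h e : nat -> F).
Hypothesis Ev0 : E v0 = 0.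
Hypothesis Hv0 : forall n, H n v0 = h n *: v0.
Hypothesis he : newton h e.

Section Divided.
Variable N : nat.
Variable divided : nat -> nat -> V.
Hypothesis divided0 : forall s, divided 0 s = e s *: v0.
Hypothesis divided_rec : forall d s, d.+1%:R *: divided d.+1 s =
  \sum_(n < N) (-1) ^+ n *: X n (shift n (divided d) s).

Definition weighted_sum (c : nat -> F) d s : V :=
  \sum_(n < N) ((-1) ^+ n * c n) *: X n (shift n (divided d) s).

Lemma dividedS d s :
  d.+1%:R *: divided d.+1 s = weighted_sum (fun=> 1) d s.
Proof.
by rewrite divided_rec; apply: eq_bigr => n _; rewrite mulr1.
Qed.

(** The value at d - 1; terms containing X(z)^(d-1) are absent when d = 0. *)
Definition previous (f : nat -> V) (d : nat) : V := if d is d'.+1 then f d' else 0.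

Lemma scale_succ_inj d : injective (fun v : V => d.+1%:R *: v).
Proof.
by move=> v w /(congr1 (fun v => d.+1%:R^-1 *: v)); rewrite !scalerA mulVf ?pnatr_eq0 // !scale1r.
Qed.

Lemma divided_lt d s : (s < d)%N -> divided d s = 0.
Proof.
elim: d s => // d IH s sd; apply: (@scale_succ_inj d).
rewrite divided_rec big1 ?scaler0 // => n _.
rewrite /shift; case: ifP => ns; last by rewrite raddf0 scaler0.
by rewrite IH ?raddf0 ?scaler0 //; lia.
Qed.

Lemma shift_dividedS l d s :
  \sum_(n < N) (-1) ^+ n *: X n (shift l (shift n (divided d)) s) =
  d.+1%:R *: shift l (divided d.+1) s.
Proof.
rewrite -shiftZ [RHS](_ : _ = shift l (weighted_sum (fun=> 1) d) s); last first.
  by apply: eq_shift => t _; exact: dividedS.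
rewrite /weighted_sum shift_sum; apply: eq_bigr => n _; rewrite mulr1 shiftZ.
by rewrite /shift; case: (l < s)%N => //; rewrite raddf0.
Qed.

(** Replacing one factor of X(z)^d/d! : the product of X(z) and
X(z)^(d-1)/(d-1)! is d times X(z)^d/d!. The other factor may be any sum of the
X's, as all of them commute. *)
Lemma shift_raise (c : nat -> F) (r : nat -> nat) d s :
  \sum_(k < N) (-1) ^+ k *: X k (previous (fun d' =>
    \sum_(l < N) c l *: X (r l) (shift k (shift l (divided d')) s)) d) =
  d%:R *: \sum_(l < N) c l *: X (r l) (shift l (divided d) s).
Proof.
case: d => [|d] /=.
  by rewrite scale0r big1 // => k _; rewrite raddf0 scaler0.
under eq_bigr do rewrite linear_sum /= scaler_sumr.
rewrite exchange_big scaler_sumr; apply: eq_bigr => l _ /=.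
rewrite [RHS]scalerA [_ * c l]mulrC -[RHS]scalerA.
rewrite -[d.+1%:R *: X (r l) _]linearZ -shift_dividedS.
rewrite linear_sum scaler_sumr; apply: eq_bigr => k _; rewrite [X k _]linearZ /= XX shiftC [X (r l) (_ *: X k _)]linearZ /=.
by rewrite !scalerA mulrC.
Qed.

Lemma H_shift n k d s :
  (forall t, H n (divided d t) = h n *: divided d t -
    2%:R *: previous (fun d' =>
      \sum_(l < N) (-1) ^+ l *: X (n + l).+1 (shift l (divided d') t)) d) ->
  H n (shift k (divided d) s) = h n *: shift k (divided d) s -
    2%:R *: previous (fun d' =>
      \sum_(l < N) (-1) ^+ l *: X (n + l).+1 (shift k (shift l (divided d')) s)) d.
Proof.
move=> IH; rewrite {1 2}/shift; case: (ltnP k s) => ks.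
  rewrite IH; congr (_ - _ *: _); case: d {IH} => //= d.
  by apply: eq_bigr => l _; rewrite [in RHS]/shift ks.
rewrite raddf0 scaler0 sub0r.
case: d {IH} => [|d]; rewrite /= ?scaler0 ?oppr0 // big1 ?scaler0 ?oppr0 // => l _.
by rewrite shift_ge // raddf0 scaler0.
Qed.

Lemma H_divided n d s :
  H n (divided d s) = h n *: divided d s -
    2%:R *: previous (fun d' =>
      \sum_(k < N) (-1) ^+ k *: X (n + k).+1 (shift k (divided d') s)) d.
Proof.
elim: d s => [|d IH] s /=.
  by rewrite divided0 linearZ /= Hv0 scaler0 subr0 !scalerA mulrC.
apply: (@scale_succ_inj d); rewrite -[LHS]linearZ dividedS linear_sum.
set A := \sum_(k < N) _ *: X (n + k).+1 _.
transitivity (h n *: (d.+1%:R *: divided d.+1 s) - 2%:R *: (d%:R *: A) - 2%:R *: A); last first.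
  rewrite scalerBr -addrA -opprD; congr (_ - _); first by rewrite !scalerA mulrC.
  by rewrite !scalerA -scalerDl -natr1; congr (_ *: _); ring.
rewrite -(shift_raise (fun k => (-1) ^+ k) (fun k => (n + k).+1)) dividedS.
rewrite /weighted_sum /A !scaler_sumr -!sumrB; apply: eq_bigr => k _.
rewrite [H n _]linearZ /= HX H_shift // mulr1 [X k (_ - _)]linearB /= ![X k (_ *: _)]linearZ /=.
rewrite !scalerBr.
by rewrite !scalerA ![_ * (-1) ^+ k]mulrC.
Qed.

(** The product of h(z) and X(z)^d/d! e(z) is computed as z (X^d/d! e)' -
X^(d-1)/(d-1)! z X' e. *)
Lemma newton_divided d s : (s <= N)%N ->
  \sum_(n < N) ((-1) ^+ n * h n) *: shift n (divided d) s =
  s%:R *: divided d s - previous (fun d' => weighted_sum (fun n => n.+1%:R) d' s) d.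
Proof.
elim: d s => [|d IH] s sN.
  rewrite subr0 divided0 scalerA (he sN) scaler_suml; apply: eq_bigr => n _ /=.
  by rewrite /shift; case: ifP; rewrite ?divided0 ?mulr0 ?scale0r ?scaler0 ?scalerA.
apply: (@scale_succ_inj d); rewrite [LHS]scaler_sumr /=.
under eq_bigr do rewrite scalerA mulrC -scalerA -shift_dividedS scaler_sumr.
rewrite exchange_big /= -/(divided d.+1 s).
pose W := weighted_sum (fun n => n.+1%:R) d s.
transitivity (s%:R *: (d.+1%:R *: divided d.+1 s) - W - d%:R *: W); last first.
  rewrite scalerBr -addrA -opprD; congr (_ - _); first by rewrite !scalerA mulrC.
  by rewrite -[X in X + _]scale1r -scalerDl addrC natr1.
rewrite dividedS /W {2}/weighted_sum -(shift_raise (fun n => (-1) ^+ n * n.+1%:R) id).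
rewrite /weighted_sum scaler_sumr -!sumrB; apply: eq_bigr => k _.
transitivity ((-1) ^+ k *: X k (\sum_(n < N)
    ((-1) ^+ n * h n) *: shift k (shift n (divided d)) s)).
  rewrite linear_sum /= scaler_sumr; apply: eq_bigr => n _.
  by rewrite [X k (_ *: _)]linearZ /= !scalerA mulrC shiftC.
have -> : \sum_(n < N) ((-1) ^+ n * h n) *: shift k (shift n (divided d)) s =
    (s%:R - k.+1%:R) *: shift k (divided d) s - previous (fun d' =>
      \sum_(n < N) ((-1) ^+ n * n.+1%:R) *: X n (shift k (shift n (divided d')) s)) d.
  case: (ltnP k s) => ks; last first.
    rewrite [in RHS]shift_ge // scaler0 sub0r big1 => [|n _]; last by rewrite shift_ge ?scaler0.
    by case: (d) => [|d'] /=; rewrite ?oppr0 // big1 ?oppr0 // => n _; rewrite shift_ge // raddf0 scaler0.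
  under eq_bigr do rewrite /shift ks -/(shift _ _ _).
  rewrite IH ?(leq_trans (leq_subr _ _)) // /shift ks natrB //.
rewrite [X k (_ - _)]linearB /= [X k (_ *: _)]linearZ /= mulr1 scalerBr !scalerA.
by rewrite mulrBr scalerBl [_ * s%:R]mulrC.
Qed.

(** Commuting E past X(z)^d/d! produces H(z) once in place of a factor X(z),
and then the commutators of H(z) with the remaining factors. *)
Lemma E_divided d s : (s <= N)%N ->
  E (divided d.+1 s) = (s%:R - d%:R) *: divided d s.
Proof.
elim: d s => [|d IH] s sN.
  apply: (@scale_succ_inj 0); rewrite -[LHS]linearZ dividedS linear_sum.
  rewrite scale1r subr0 -[RHS]subr0 -(newton_divided 0 sN); apply: eq_bigr => n _.
  rewrite [E _]linearZ /= EX H_shift => [|t]; last exact: H_divided.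
  have -> : E (shift n (divided 0) s) = 0.
    by rewrite /shift; case: ifP => _; rewrite ?raddf0 // divided0 linearZ /= Ev0 scaler0.
  by rewrite /= scaler0 subr0 mulr1 raddf0 add0r scalerA.
apply: (@scale_succ_inj d.+1); rewrite -[LHS]linearZ dividedS linear_sum.
pose S0 := weighted_sum (fun=> 1) d s; pose S1 := weighted_sum (fun n => n.+1%:R) d s.
(* The double commutator: all pairs with the same n + l contribute equally. *)
have T3 : \sum_(n < N) (-1) ^+ n *: (\sum_(l < N)
    (-1) ^+ l *: X (n + l).+1 (shift n (shift l (divided d)) s)) = S0 - S1.
  pose g n := - ((-1) ^+ n *: X n (shift n (divided d) s)).
  transitivity (\sum_(k < N) \sum_(l < N) g (k + l).+1).
    apply: eq_bigr => k _; rewrite scaler_sumr; apply: eq_bigr => l _.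
    by rewrite /g scalerA shift_shift exprS mulN1r scaleNr opprK exprD.
  rewrite sum_shift_index => [|n nN].
    rewrite /S0 /S1 /weighted_sum -sumrB; apply: eq_bigr => n _.
    rewrite -scalerBl -mulrBr /g -[n.+1]addn1 natrD opprD addrC addrNK.
    by rewrite mulrN scaleNr mulNrn scalerMnl mulr_natr.
  by rewrite /g shift_ge ?(leq_trans sN) // raddf0 scaler0 oppr0.
transitivity (((s%:R - d%:R) *: S0 - S1) + (s%:R *: divided d.+1 s - S1) - 2%:R *: (S0 - S1)).
  rewrite -(newton_divided d.+1 sN) -T3 scaler_sumr /S0 /S1 /weighted_sum scaler_sumr.
  rewrite -!sumrB -!big_split -!sumrB /=; apply: eq_bigr => n _.
  rewrite [E _]linearZ /= EX H_shift => [|t]; last exact: H_divided.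
  have -> : E (shift n (divided d.+1) s) = (s%:R - n.+1%:R - d%:R) *: shift n (divided d) s.
    rewrite /shift; case: ifP => ns; last by rewrite raddf0 scaler0.
    by rewrite IH ?natrB // (leq_trans (leq_subr _ _)).
  rewrite linearZ /= mulr1 !scalerDr !scalerN !scalerA addrA.
  congr (_ + _ + _); last by rewrite [2%:R * _]mulrC.
  by rewrite -scalerBl; congr (_ *: _); ring.
have -> : S0 = d.+1%:R *: divided d.+1 s by rewrite dividedS.
rewrite [2%:R *: _]scalerBr opprB [2%:R *: S1]scaler_nat mulr2n [X in X + _]addrACA -opprD.
rewrite addrA addrNK !scalerA -scalerDl -scalerBl; congr (_ *: _).
by rewrite -!natr1; ring.
Qed.

Lemma divided_power s : (0 < N)%N ->
  s`!%:R *: divided s s = iter s (X 0) (e 0 *: v0).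
Proof.
move=> N0; elim: s => [|s IH]; first by rewrite scale1r divided0.
rewrite factS natrM mulrC -scalerA divided_rec iterS -IH [RHS]linearZ /=.
congr (_ *: _); case: (N) N0 => // N' _.
rewrite big_ord_recl big1 ?addr0 => [|n _].
  by rewrite scale1r /shift /= subn1.
rewrite /shift; case: ifP => ns; last by rewrite raddf0 scaler0.
rewrite divided_lt ?raddf0 ?scaler0 //; move: ns; rewrite lift0; lia.
Qed.

Lemma raise_divided s k : (s <= N)%N -> (k <= s)%N ->
  iter k E (divided k s) = (\prod_(i < k) (s%:R - i%:R)) *: (e s *: v0).
Proof.
move=> sN; elim: k => [|k IH] ks; first by rewrite big_ord0 scale1r divided0.
have iterZ j (a : F) v : iter j E (a *: v) = a *: iter j E v.
  by elim: j => //= j ->; rewrite linearZ.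
by rewrite iterSr E_divided // iterZ IH ?(ltnW ks) // big_ord_recr /= scalerA mulrC.
Qed.

End Divided.

(** Characteristic 0 provides the divided powers assumed above. *)
Fixpoint divided_vector N (d s : nat) : V :=
  if d is d'.+1 then
    d%:R^-1 *: \sum_(n < N) (-1) ^+ n *: X n (shift n (divided_vector N d') s)
  else e s *: v0.

(** The coefficient of z^s in X(z)^s/s! e(z) v0 is X_0^s/s! v0, and applying E
to it s times gives s! e_s v0. *)
Lemma elementary_vanish s :
  v0 != 0 -> e 0 = 1 -> iter s (X 0) v0 = 0 -> e s = 0.
Proof.
(* Any cut-off beyond s will do; it must be positive even when s = 0. *)
move=> v00 e0 Xs; pose w := divided_vector s.+1.
have w0 t : w 0%N t = e t *: v0 by [].
have wS d t : d.+1%:R *: w d.+1 t =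
    \sum_(n < s.+1) (-1) ^+ n *: X n (shift n (w d) t).
  by rewrite /w [divided_vector _ _.+1]/= scalerA mulfV ?pnatr_eq0 // scale1r.
have ws : w s s = 0.
  apply/eqP; have := divided_power w0 wS s (ltn0Sn s).
  rewrite e0 scale1r Xs => /eqP; rewrite scaler_eq0 pnatr_eq0.
  by rewrite eqn0Ngt fact_gt0.
have := raise_divided w0 wS (leqnSn s) (leqnn s).
have iterE0 k : iter k E 0 = 0 by elim: k => //= k ->; rewrite raddf0.
rewrite ws iterE0 => /esym/eqP; rewrite !scaler_eq0 (negbTE v00) orbF.
case/orP => [|/eqP //]; rewrite prodf_seq_eq0 => /hasP[i _ /=].
by rewrite subr_eq0 eqr_nat gtn_eqF.
Qed.

End CurrentSl2.

Section Newton.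
Variable F : numClosedFieldType.
Implicit Types h e : nat -> F.

(** The values e_s, ..., e_0 in this order, so that the recursion can look at
all the previous ones. *)
Fixpoint elementary_rec h s : seq F :=
  if s is s'.+1 then
    (s%:R^-1 * \sum_(n < s) (-1) ^+ n * h n * (elementary_rec h s')`_n)
      :: elementary_rec h s'
  else [:: 1].

Lemma newton_exists h : exists2 e, e 0 = 1 & newton h e.
Proof.
exists (fun s => (elementary_rec h s)`_0) => // N s sN.
have nthE n k : (n <= k)%N ->
    (elementary_rec h k)`_n = (elementary_rec h (k - n))`_0.
  by elim: k n => [|k IH] [|n] //= nk; rewrite IH.
rewrite (bigID (fun n : 'I_N => (n < s)%N)) /= [X in _ = _ + X]big1 ?addr0; last first.
  by move=> n; rewrite -leqNgt => ns; rewrite shift_ge ?mulr0.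
case: s sN => [|s] sN; first by rewrite mul0r big_pred0.
rewrite -(big_ord_widen N (fun n => (-1) ^+ n * h n *
  shift n (fun s => (elementary_rec h s)`_0) s.+1) sN) /=.
rewrite mulrA mulfV ?pnatr_eq0 // mul1r; apply: eq_bigr => n _.
by rewrite nthE -1?ltnS // /shift ltn_ord subSS.
Qed.

(** The last term of the identity of degree n + 1 is h_n up to sign. *)
Lemma newton_inj h h' e : e 0 = 1 -> newton h e -> newton h' e -> h =1 h'.
Proof.
move=> e0 he he' n; elim/ltn_ind: n => n IH.
have := he' n.+1 n.+1 (leqnn _); rewrite (he n.+1 n.+1 (leqnn _)) !big_ord_recr /=.
rewrite (eq_bigr (fun k : 'I_n => (-1) ^+ k * h' k * shift k e n.+1)); last first.
  by move=> k _; rewrite IH.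
move/addrI; rewrite /shift ltnSn subnn e0 !mulr1.
by apply: mulfI; rewrite signr_eq0.
Qed.

(** A further factor 1 + y z adds y^(n+1) to the power sums; the extra terms
telescope. *)
Lemma newton_prod (r : seq F) :
  newton (fun n => \sum_(y <- r) y ^+ n.+1)
         (fun s => (\prod_(y <- r) (1 + y *: 'X))`_s).
Proof.
elim: r => [|y r IH] N s sN.
  rewrite big_nil coefC big1 => [|n _]; last by rewrite big_nil mulr0 mul0r.
  by case: s sN => [|s] _; rewrite ?mul0r ?mulr0.
pose e s := (\prod_(z <- r) (1 + z *: 'X))`_s.
pose h n := \sum_(z <- r) z ^+ n.+1.
pose e2 s := (\prod_(z <- y :: r) (1 + z *: 'X))`_s.
have eE t : e2 t = e t + y * shift 0 e t.
  rewrite /e2 big_cons mulrDl mul1r coefD -scalerAl coefZ coefXM /shift subn1.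
  by case: t => [|t].
have shE n : shift n e2 s = shift n e s + y * shift n.+1 e s.
  rewrite -[n.+1]addn0 addSn -shift_shift /shift; case: ifP => _; last by rewrite mulr0 addr0.
  by rewrite eE.
change (s%:R * e2 s =
  \sum_(n < N) (-1) ^+ n * (\sum_(z <- y :: r) z ^+ n.+1) * shift n e2 s).
rewrite eE; under eq_bigr => n _ do
  rewrite shE big_cons -/(h n) [_ * (_ + h n)]mulrDr mulrDl [_ * h n * _]mulrDr.
rewrite !big_split /= -(IH N s sN : s%:R * e s = \sum_(n < N) (-1) ^+ n * h n * shift n e s).
pose t n := (-1) ^+ n * y ^+ n.+1 * shift n e s.
have -> : \sum_(n < N) (-1) ^+ n * y ^+ n.+1 * (shift n e s + y * shift n.+1 e s) =
    y * shift 0 e s.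
  transitivity (- \sum_(0 <= n < N) (t n.+1 - t n)).
    rewrite big_mkord -sumrN; apply: eq_bigr => n _; rewrite /t mulrDr opprB; congr (_ + _).
    by rewrite !exprS; ring.
  by rewrite telescope_sumr // /t (shift_ge _ sN) mulr0 sub0r opprK expr0 mul1r expr1.
have -> : \sum_(n < N) (-1) ^+ n * h n * (y * shift n.+1 e s) =
    y * ((s%:R - 1) * shift 0 e s).
  under eq_bigr do rewrite mulrCA -[_.+1]addn0 addSn addnC -shift_shift.
  rewrite -mulr_sumr; congr (_ * _).
  rewrite /shift; case: s sN {shE t} => [|s] sN.
    by rewrite mulr0 big1 // => n _; rewrite mulr0.
  by rewrite /= subn1 -natr1 addrK; exact/esym/(IH N s (ltnW sN)).
by ring.
Qed.

(** The polynomial sum_s e_s z^s has constant term 1, hence is a product of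
factors 1 + y z, where y ranges over the opposite inverses of its roots. *)
Lemma newton_power_sums h e K :
  e 0 = 1 -> newton h e -> (forall s, (K <= s)%N -> e s = 0) ->
  exists2 r : seq F, 0 \notin r & forall n, h n = \sum_(y <- r) y ^+ n.+1.
Proof.
move=> e0 he eK; pose P := \poly_(s < K.+1) e s.
have PE s : P`_s = e s.
  by rewrite coef_poly; case: ltnP => // Ks; rewrite eK // ltnW.
have P0 : P.[0] = 1 by rewrite horner_coef0 PE.
have [r rP] := closed_field_poly_normal P.
have rn0 : 0 \notin r.
  apply/negP; rewrite -root_prod_XsubC => /rootP r0; have := P0.
  by rewrite {1}rP hornerZ r0 mulr0 => /esym/eqP; rewrite oner_eq0.
have lin y : y \in r -> 'X - y%:P = (- y) *: (1 + (- y^-1) *: 'X).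
  move=> yr; have y0 : y != 0 by apply: contraNneq rn0 => <-.
  by rewrite scalerDr scalerA mulrNN mulfV // scale1r alg_polyC polyCN addrC.
pose r' := [seq - y^-1 | y <- r].
have PE' : P = \prod_(y <- r') (1 + y *: 'X).
  have : P = (lead_coef P * \prod_(y <- r) (- y)) *: \prod_(y <- r') (1 + y *: 'X).
    rewrite {1}rP big_map -scalerA; congr (_ *: _); rewrite -scaler_prod.
    by rewrite [LHS]big_seq [RHS]big_seq; apply: eq_bigr => y /lin.
  set c := _ * _; move=> PE'; have := P0.
  rewrite {1}PE' hornerZ horner_prod big1_seq => [|y _].
    by rewrite mulr1 => c1; rewrite PE' c1 scale1r.
  by rewrite hornerD hornerZ hornerX hornerC mulr0 addr0.
exists r'.
  apply/mapP => -[y yr /eqP]; rewrite eq_sym oppr_eq0 invr_eq0 => /eqP y0.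
  by rewrite -y0 yr in rn0.
apply: newton_inj e0 he _ => N s sN.
have := newton_prod r' sN; rewrite -PE' PE => ->; apply: eq_bigr => n _.
by congr (_ * _); rewrite /shift PE.
Qed.

End Newton.

Lemma current_sl2_weights (F : numClosedFieldType) (V : lmodType F)
    (E : {linear V -> V}) (X H : nat -> {linear V -> V}) (v0 : V) (h : nat -> F) :
  (forall n v, E (X n v) = X n (E v) + H n v) ->
  (forall n k v, H n (X k v) = X k (H n v) - 2%:R *: X (n + k).+1 v) ->
  (forall n k v, X n (X k v) = X k (X n v)) ->
  E v0 = 0 -> (forall n, H n v0 = h n *: v0) -> v0 != 0 ->
  (exists K, forall s, (K <= s)%N -> iter s (X 0) v0 = 0) ->
  exists2 r : seq F, 0 \notin r & forall n, h n = \sum_(y <- r) y ^+ n.+1.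
Proof.
move=> EX HX XX Ev0 Hv0 v00 [K XK]; have [e e0 he] := newton_exists h.
apply: (newton_power_sums (K := K) e0 he) => s Ks.
by apply: (elementary_vanish EX HX XX Ev0 Hv0 he) => //; exact: XK.
Qed.

(** * The weight attached to one simple root *)

Section Restriction.
Variables (F : fieldType) (A : algType F) (V : lmodType A).

(** The underlying vector space of a module over an algebra. *)
Definition restriction : Type := V.
HB.instance Definition _ := GRing.Zmodule.on restriction.

Definition restr_scale (c : F) (v : restriction) : restriction := c%:A *: (v : V).

Fact restr_scaleA a b v : restr_scale a (restr_scale b v) = restr_scale (a * b) v.
Proof. by rewrite /restr_scale scalerA mulr_algl scalerA. Qed.
Fact restr_scale1 : left_id 1 restr_scale.
Proof. by move=> v; rewrite /restr_scale !scale1r. Qed.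
Fact restr_scaleDr : right_distributive restr_scale +%R.
Proof. by move=> a v w; exact: scalerDr. Qed.
Fact restr_scaleDl v : {morph restr_scale^~ v : a b / a + b}.
Proof. by move=> a b; rewrite /restr_scale !scalerDl. Qed.
HB.instance Definition _ := GRing.Zmodule_isLmodule.Build F restriction
  restr_scaleA restr_scale1 restr_scaleDr restr_scaleDl.

Lemma restr_scaleE (c : F) (v : restriction) : c *: v = c%:A *: (v : V) :> V.
Proof. by []. Qed.

Definition action (x : A) (v : restriction) : restriction := x *: (v : V).

Fact action_linear x : linear (action x).
Proof.
move=> c v w; rewrite /action scalerDr; congr (_ + _).
by rewrite !restr_scaleE !scalerA mulr_algl mulr_algr.
Qed.
HB.instance Definition _ x := GRing.isLinear.Build F restriction restriction
  *:%R (action x) (action_linear x).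

End Restriction.

Section PolynomialIndexed.
Variables (F : fieldType) (M : lmodType F).

(** Indexing by polynomials instead of exponents turns the brackets of families
into products of polynomials. *)
Definition poly_index (g : nat -> M) (f : {poly F}) : M := \sum_(t < size f) f`_t *: g t.

Lemma poly_index_widen g (f : {poly F}) n : (size f <= n)%N ->
  poly_index g f = \sum_(t < n) f`_t *: g t.
Proof.
move=> fn; rewrite /poly_index (big_ord_widen n (fun t => f`_t *: g t) fn) big_mkcond /=.
apply: eq_bigr => t _; case: ltnP => // tf.
by rewrite nth_default ?scale0r.
Qed.

Fact poly_index_linear g : linear (poly_index g).
Proof.
move=> a f f'; pose n := maxn (size f) (size f').
rewrite !(@poly_index_widen g _ n) ?leq_maxl ?leq_maxr //; last first.
  apply: leq_trans (size_polyD _ _) _; rewrite geq_max leq_maxr andbT.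
  exact: leq_trans (size_scale_leq _ _) (leq_maxl _ _).
rewrite scaler_sumr -big_split; apply: eq_bigr => t _ /=.
by rewrite coefD coefZ scalerDl scalerA.
Qed.
HB.instance Definition _ g := GRing.isLinear.Build F {poly F} M *:%R
  (poly_index g) (poly_index_linear g).

Lemma poly_indexXn g n : poly_index g 'X^n = g n.
Proof.
rewrite /poly_index size_polyXn big_ord_recr /= coefXn eqxx scale1r.
by rewrite big1 ?add0r // => t _; rewrite coefXn ltn_eqF ?scale0r.
Qed.

Lemma poly_linear_ind (P : {poly F} -> Prop) :
  (forall a f f', P f -> P f' -> P (a *: f + f')) -> (forall n, P 'X^n) ->
  forall f, P f.
Proof.
move=> PL PX f; have P0 : P 0.
  by have := PL (-1) _ _ (PX 0) (PX 0); rewrite scaleN1r addNr.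
rewrite -[f]coefK poly_def; elim: (size f) => [|n IH]; first by rewrite big_ord0.
by rewrite big_ord_recr /= addrC; exact: PL.
Qed.

End PolynomialIndexed.

Section RankOne.
Variables (m : nat) (F : numClosedFieldType) (Q : 'I_m.-1 -> F).
Local Notation U := (Ugl Q).
Variable i : 'I_m.-1.

Local Notation Xminus := (@poly_index F U (UX Q false i)).
Local Notation Jcurrent := (@poly_index F U (UJ Q i)).

Local Notation q := (1 - Q i *: 'X).

Lemma XminusXn t : Xminus 'X^t = UX Q false i t.
Proof. exact: poly_indexXn. Qed.
Lemma JcurrentXn t : Jcurrent 'X^t = UJ Q i t.
Proof. exact: poly_indexXn. Qed.

Lemma raise_Xminus f :
  UX Q true i 0 * Xminus f = Xminus f * UX Q true i 0 + Jcurrent (q * f).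
Proof.
elim/poly_linear_ind: f => [a f g IHf IHg|t].
  rewrite linearP mulrDr mulrDl -scalerAr -scalerAl IHf IHg scalerDr addrACA.
  by rewrite mulrDr -scalerAr [Jcurrent (_ + _)]linearP.
rewrite XminusXn UXX eqxx addn0; congr (_ + _).
rewrite mulrBl mul1r -scalerAl -exprS -[in RHS]scaleNr [X in Jcurrent X]addrC.
by rewrite linearP /= !JcurrentXn scaleNr addrC.
Qed.

Lemma UJ_UX s t : UJ Q i s * UX Q false i t =
  UX Q false i t * UJ Q i s - 2%:R *: UX Q false i (s + t).
Proof.
rewrite /UJ mulrBl mulrBr !UI_UX opprD addrACA; congr (_ + _).
have neq : (ord_this i == ord_next i) = false by rewrite -val_eqE /= ltn_eqF.
rewrite !cartan'E !eqxx neq [ord_next i == _]eq_sym neq -scalerBl -scaleNr.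
by congr (_ *: _); rewrite /=; ring.
Qed.

Lemma Jcurrent_Xminus f g : Jcurrent f * Xminus g =
  Xminus g * Jcurrent f - 2%:R *: Xminus (f * g).
Proof.
elim/poly_linear_ind: f => [a f f' IHf IHf'|s].
  rewrite linearP mulrDr mulrDl -scalerAr -scalerAl IHf IHf' scalerBr addrACA.
  rewrite -opprD mulrDl -scalerAl [Xminus (_ + _)]linearP scalerDr.
  by rewrite !scalerA [a * _]mulrC.
elim/poly_linear_ind: g => [a f f' IHf IHf'|t].
  rewrite linearP mulrDr mulrDl -scalerAr -scalerAl IHf IHf' scalerBr addrACA.
  rewrite -opprD mulrDr -scalerAr [Xminus (_ + _)]linearP scalerDr.
  by rewrite !scalerA [a * _]mulrC.
by rewrite -exprD !XminusXn JcurrentXn UJ_UX.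
Qed.

Lemma Xminus_comm f g : Xminus f * Xminus g = Xminus g * Xminus f.
Proof.
elim/poly_linear_ind: f => [a f f' IHf IHf'|s].
  by rewrite linearP mulrDr mulrDl -scalerAr -scalerAl IHf IHf'.
elim/poly_linear_ind: g => [a f f' IHf IHf'|t].
  by rewrite linearP mulrDr mulrDl -scalerAr -scalerAl IHf IHf'.
by rewrite !XminusXn UX_comm.
Qed.

Lemma grading_Xminus f : grading Q * Xminus f = Xminus f * grading Q - Xminus f.
Proof.
elim/poly_linear_ind: f => [a f g IHf IHg|t].
  rewrite linearP mulrDr mulrDl -scalerAr -scalerAl IHf IHg scalerBr addrACA.
  by rewrite -opprD.
by rewrite XminusXn grading_UX /pm scaleN1r.
Qed.

Variables (V : lmodType U) (u : 'I_m -> nat -> F) (v0 : V).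
Hypotheses (v0_neq0 : v0 != 0) (hw : hw_vector u v0) (Vfd : finite_dimensional V).

(** The eigenvalue of J_{i,t} on v0, with values in a vector space so that it
extends linearly from the monomials x^t to polynomials. *)
Definition weight_diff t : F^o := u (ord_this i) t - u (ord_next i) t.

Lemma Jcurrent_hw f : Jcurrent f *: v0 = (poly_index weight_diff f)%:A *: v0.
Proof.
elim/poly_linear_ind: f => [a f g IHf IHg|t].
  rewrite [Jcurrent _]linearP [poly_index _ _]linearP /= scalerDl fscaleZ IHf IHg.
  by rewrite fscaleA -fscaleDl.
by rewrite JcurrentXn poly_indexXn /UJ scalerBl !hw.2 -fscaleBl.
Qed.

(** The relations of a current algebra in the variable p q: indexing by p^(n+1)
q^n makes the factor q produced by the bracket of X^+ and X^- disappear into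
the powers of p q. *)
Lemma rank_one_weights (p : {poly F}) : exists2 r : seq F, 0 \notin r &
  forall n, poly_index weight_diff ((p * q) ^+ n.+1) = \sum_(y <- r) y ^+ n.+1.
Proof.
have q_exp n : q * (p ^+ n.+1 * q ^+ n) = (p * q) ^+ n.+1.
  by rewrite exprMn [q ^+ n.+1]exprS mulrCA.
have [K XK] := fd_lowering Vfd (grading_Xminus p) (grading_hw hw).
pose E : {linear restriction V -> restriction V} := action (UX Q true i 0).
pose X n : {linear restriction V -> restriction V} := action (Xminus (p ^+ n.+1 * q ^+ n)).
pose H n : {linear restriction V -> restriction V} := action (Jcurrent ((p * q) ^+ n.+1)).
have [] := @current_sl2_weights F (restriction V) E X H (v0 : restriction V)
  (fun n => poly_index weight_diff ((p * q) ^+ n.+1)).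
- move=> n v; rewrite /E /X /H /= /action !scalerA raise_Xminus scalerDl.
  by rewrite -q_exp.
- move=> n k v; rewrite /X /H /= restr_scaleE /action !scalerA Jcurrent_Xminus scalerBl.
  by rewrite mulr_algl exprMn mulrACA -!exprD !addSn !addnS.
- by move=> n k v; rewrite /X /= /action !scalerA Xminus_comm.
- exact: hw.1.
- by move=> n; exact: Jcurrent_hw.
- exact: v0_neq0.
- exists K => s /XK e; rewrite -[RHS]e.
  elim: s {e} => [|s IH]; first by rewrite scale1r.
  by rewrite exprS -scalerA -IH /= /X /= /action mulr1.
by move=> r r0 rE; exists r.
Qed.
End RankOne.

(** * Recovering the parameters *)

Section PowerSumWeights.
Variable F : numClosedFieldType.
Implicit Types (d : nat -> F^o) (r : seq F).

Lemma roots_of_prod r : perm_eq (roots_of (\prod_(g <- r) ('X - g%:P))) r.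
Proof.
apply: prod_XsubC_eq; rewrite -monic_roots //; exact: monic_prod_XsubC.
Qed.

Lemma poly_index_comp d r (q : {poly F}) :
  (forall n, poly_index d (q ^+ n.+1) = \sum_(y <- r) y ^+ n.+1) ->
  forall f, poly_index d (f \Po q) =
    \sum_(y <- r) f.[y] + f.[0] * (d 0 - (size r)%:R).
Proof.
move=> h; elim/poly_linear_ind => [a f g IHf IHg|n].
  rewrite comp_polyD comp_polyZ linearP /= IHf IHg hornerD hornerZ /= [_ *: _]mulrDr.
  under [in RHS]eq_bigr do rewrite hornerD hornerZ.
  rewrite big_split -mulr_sumr /= mulrDl mulrA addrACA //.
rewrite comp_Xn_poly hornerXn; under eq_bigr do rewrite hornerXn.
case: n => [|n]; last by rewrite h expr0n mul0r addr0.
under eq_bigr do rewrite expr0.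
rewrite !expr0 -[1 in LHS](expr0 'X) poly_indexXn mul1r.
by rewrite big_const_seq count_predT iter_addr_0 addrC subrK.
Qed.

(** Since 1 - Q x generates F[x], the monomial x^t is (Q^{-1} (1 - X))^t
evaluated at it. So the roots are (1 - y)/Q, which avoid 1/Q because y != 0,
and the defect at t = 0 is carried by the point 1/Q. *)
Lemma parameters_neq0 d (Q : F) r : Q != 0 -> 0 \notin r ->
  (forall n, poly_index d ((1 - Q *: 'X) ^+ n.+1) = \sum_(y <- r) y ^+ n.+1) ->
  exists phi beta, [/\ monic_set Q phi, Bset Q beta &
    forall t, d t = \sum_(g <- roots_of phi) g ^+ t + Q^-1 ^+ t * beta].
Proof.
move=> Q0 r0 /poly_index_comp h.
(* The points where 1 - Q x takes the values y. *)
pose s := [seq Q^-1 * (1 - y) | y <- r].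
exists (\prod_(g <- s) ('X - g%:P)), (d 0 - (size r)%:R); split.
- split; first exact: monic_prod_XsubC.
  move=> _; rewrite root_prod_XsubC; apply/mapP => -[y yr /eqP].
  rewrite -{1}[Q^-1]mulr1 (inj_eq (mulfI _)) ?invr_neq0 // -subr_eq0 opprB.
  by rewrite addrC subrK => /eqP y0; rewrite -y0 yr in r0.
- by rewrite /Bset (negbTE Q0).
move=> t; rewrite (perm_big _ (roots_of_prod _)) /= big_map.
have := h ((Q^-1 *: (1 - 'X)) ^+ t).
have -> : ((Q^-1 *: (1 - 'X)) ^+ t) \Po (1 - Q *: 'X) = 'X^t.
  rewrite rmorphXn /= linearZ /= linearB /= comp_polyX -[1 \Po _]/((1%:P : {poly F}) \Po _) comp_polyC.
  by rewrite opprB addrC subrK scalerA mulVf // scale1r.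
rewrite poly_indexXn => ->.
under [in LHS]eq_bigr do rewrite horner_exp hornerZ hornerD hornerN hornerX hornerC.
by rewrite horner_exp hornerZ hornerD hornerN hornerX hornerC subr0 mulr1.
Qed.

(** The first hypothesis gives d_t = sum_y y^t + c 0^t for some scalar c.
Comparing with the second one at the point 1, which no y + 1 attains, c is the
number of entries 1 in s; this is the multiplicity of the root 0. *)
Lemma parameters_eq0 d r s : 0 \notin r ->
  (forall n, poly_index d ('X ^+ n.+1) = \sum_(y <- r) y ^+ n.+1) ->
  (forall n, poly_index d (('X + 1) ^+ n.+1) = \sum_(y <- s) y ^+ n.+1) ->
  exists phi beta, [/\ monic_set (0 : F) phi, Bset (0 : F) beta &
    forall t, d t = \sum_(g <- roots_of phi) g ^+ t + (0 : F)^-1 ^+ t * beta].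
Proof.
move=> r0 /poly_index_comp hr hs.
pose c := d 0 - (size r)%:R.
have hd f : poly_index d f = \sum_(y <- r) f.[y] + f.[0] * c.
  by rewrite -hr comp_polyXr.
have shifted (g : {poly F}) : \sum_(y <- r) (y + 1) * g.[y + 1] + c * g.[1] =
    \sum_(z <- s) z * g.[z].
  elim/poly_linear_ind: g => [a f g IHf IHg|n].
    transitivity (a * (\sum_(y <- r) (y + 1) * f.[y + 1] + c * f.[1]) +
        (\sum_(y <- r) (y + 1) * g.[y + 1] + c * g.[1])); last first.
      rewrite IHf IHg mulr_sumr -big_split; apply: eq_bigr => z _ /=.
      by rewrite hornerD hornerZ; ring.
    under eq_bigr do rewrite hornerD hornerZ mulrDr mulrCA.
    by rewrite big_split -mulr_sumr /= hornerD hornerZ; ring.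
  under eq_bigr do rewrite hornerXn -exprS.
  under [RHS]eq_bigr do rewrite hornerXn -exprS.
  rewrite -hs hd hornerXn expr1n mulr1.
  under [in RHS]eq_bigr do rewrite horner_exp hornerD hornerX hornerC.
  by rewrite horner_exp hornerD hornerX hornerC add0r expr1n mul1r.
pose k := count_mem 1 s.
have ck : c = k%:R.
  have [f f1 fv] := interpolation ([seq y + 1 | y <- r] ++ s) 1.
  have := shifted f; rewrite [X in X + _]big1_seq ?add0r => [|y /= yr].
    rewrite (sum_vanish (x := 1)) ?mul1r => [/(mulIf f1)//|z zs z1].
    by rewrite fv ?mulr0 // mem_cat zs orbT.
  rewrite fv ?mulr0 // ?mem_cat ?(map_f (fun y => y + 1)) //.
  by rewrite -subr_eq0 addrK; apply: contraNneq r0 => <-.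
exists (\prod_(g <- r ++ nseq k 0) ('X - g%:P)), 0; split.
- by split; [exact: monic_prod_XsubC | rewrite eqxx].
- by rewrite /Bset eqxx.
move=> t; rewrite mulr0 addr0 (perm_big _ (roots_of_prod _)) /= big_cat /= big_nseq.
rewrite iter_addr_0 -poly_indexXn hd hornerXn ck mulr_natr; congr (_ + _).
by apply: eq_bigr => y _; rewrite hornerXn.
Qed.

End PowerSumWeights.

Section WeightsOfFiniteDimensional.
Variables (m : nat) (F : numClosedFieldType) (Q : 'I_m.-1 -> F).
Variables (V : lmodType (Ugl Q)) (u : 'I_m -> nat -> F) (v0 : V).
Hypotheses (v0_neq0 : v0 != 0) (hw : hw_vector u v0) (Vfd : finite_dimensional V).

Lemma fd_weight_diff i : exists phi beta,
  [/\ monic_set (Q i) phi, Bset (Q i) beta &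
    forall t, weight_diff i u t =
      \sum_(g <- roots_of phi) g ^+ t + (Q i)^-1 ^+ t * beta].
Proof.
have rk := rank_one_weights i v0_neq0 hw Vfd.
have [Q0|Q0] := eqVneq (Q i) 0.
  have [r r0 rE] := rk 'X; have [s s0 sE] := rk ('X + 1).
  rewrite Q0; apply: (@parameters_eq0 _ _ r s) => // n.
    by rewrite -rE Q0 scale0r subr0 mulr1.
  by rewrite -sE Q0 scale0r subr0 mulr1.
have [r r0 rE] := rk 1; apply: parameters_neq0 Q0 r0 _ => n.
by rewrite -rE mul1r.
Qed.

(** A weight is determined by its consecutive differences and its last row,
which is taken for h. *)
Lemma fd_weight (hm : (0 < m)%N) :
  exists2 p, parameter_set Q p & ut_weight Q p = u.
Proof.
have pbP i : exists pb : {poly F} * F, [/\ monic_set (Q i) pb.1, Bset (Q i) pb.2 &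
    forall t, weight_diff i u t =
      \sum_(g <- roots_of pb.1) g ^+ t + (Q i)^-1 ^+ t * pb.2].
  by have [phi [beta h]] := fd_weight_diff i; exists (phi, beta).
have [pb pbE] := choice pbP.
have lt : (m.-1 < m)%N by rewrite prednK.
pose p : parameters F m := (pb, fun t => u (Ordinal lt) t).
have pQ : parameter_set Q p by move=> i; have [] := pbE i.
exists p => //; apply/funext => j; apply/funext => t.
move: {2}(m.-1 - j)%N (erefl (m.-1 - j)%N) => k.
elim: k j => [|k IH] j jk.
  rewrite ut_weight_last; last by rewrite -subn_eq0 jk.
  by congr (u _ t); apply: val_inj; apply/eqP; rewrite eqn_leq /= -subn_eq0 jk /= -ltnS prednK.
have ji : (j < m.-1)%N by rewrite -subn_gt0 jk.
pose i := Ordinal ji; have jE : j = ord_this i by exact: val_inj.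
have := ut_weight_diff Q p i t; have [mon B dE] := pbE i.
rewrite u_weightE //= -dE /weight_diff jE (IH (ord_next i)); last by rewrite /= subnS jk.
by move/addIr.
Qed.

End WeightsOfFiniteDimensional.

Theorem theorem7p4 (R : realType) (m : nat) (hm : (0 < m)%N)
    (Q : 'I_m.-1 -> R[i]) :
  [/\ forall p, parameter_set Q p ->
        [/\ simple_module (simple_hw Q (ut_weight Q p)),
            highest_weight_module (ut_weight Q p)
              (simple_hw Q (ut_weight Q p)) &
            finite_dimensional (simple_hw Q (ut_weight Q p))],
      forall p p', parameter_set Q p -> parameter_set Q p' ->
        isomorphic_modules (simple_hw Q (ut_weight Q p))
                           (simple_hw Q (ut_weight Q p')) <-> p = p' &
      forall V : lmodType (Ugl Q), simple_module V -> finite_dimensional V ->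
        exists2 p, parameter_set Q p &
          isomorphic_modules V (simple_hw Q (ut_weight Q p))].
Proof.
have verma_fd p (pQ : parameter_set Q p) :=
  realizable_simple_hw (realizable_ut_weight pQ).
split.
- move=> p /verma_fd[vn fd]; split=> //; first exact: simple_hw_simple.
  exact: simple_hw_highest.
- move=> p p' pQ pQ'; split=> [iso|<-].
    apply: (ut_weight_inj hm pQ pQ').
    exact: simple_hw_iso_weight (verma_fd p pQ).1 (verma_fd p' pQ').1 iso.
  by exists idfun; exists id.
- move=> V Vs Vfd; have [u [v v0 hw]] := fd_hw_vector Vfd Vs.1.
  have [p pQ uE] := fd_weight v0 hw Vfd hm; exists p => //.
  by rewrite uE; exact: hw_simple_iso Vs v0 hw.
Qed.
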